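(* Let $r\ge 0$, $N\ge 4$ and $d\ge 4r+3$ be integers. The 3D system governing Grassmannian Q-nets of rank $r$ in $\mathbb{P}^d$ is 4D-consistent, and therefore $N$-dimensionally consistent for all $N\ge 4$. That is: for generic initial data consisting of $r$-planes $X$, $X_i$ ($1\le i\le N$) and $X_{ij}=X_{ji}$ ($1\le i<j\le N$) in $\mathbb{P}^d$ with $X_{ij}\subset\operatorname{span}(X,X_i,X_j)$, there exists a unique family $(X_S)_{S\subseteq\{1,\dots,N\}}$ of $r$-planes in $\mathbb{P}^d$, with $X_\emptyset=X$, $X_{\{i\}}=X_i$, $X_{\{i,j\}}=X_{ij}$, such that for every $S\subseteq\{1,\dots,N\}$ and all pairwise distinct $i,j,k\notin S$ the $r$-plane $X_{S\cup\{i,j,k\}}$ is the one determined by the 3D system from the seven $r$-planes $$X_S,\ X_{S\cup\{i\}},\ X_{S\cup\{j\}},\ X_{S\cup\{k\}},\ X_{S\cup\{i,j\}},\ X_{S\cup\{i,k\}},\ X_{S\cup\{j,k\}}.$$ (In particular, for $N=4$, the four values of $X_{1234}$ obtained by applying the 3D system to the four 3-dimensional faces of the 4-cube containing the vertex $\{1,2,3,4\}$ coincide.)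
   Context: $\mathbb{P}^d$ is the real projective space of dimension $d$, and $\mathbb{G}^d_r$ is the Grassmannian of $r$-planes (projective subspaces of dimension $r$) in $\mathbb{P}^d$. All dimensions are projective dimensions. Grassmannian Q-net: a map $\mathbb{Z}^N\to\mathbb{G}^d_r$ ($N\ge2$, $d>3r+2$) such that for every elementary square of $\mathbb{Z}^N$ the four $r$-planes at its vertices belong to some $(3r+2)$-plane. Subscripts denote shifts along coordinate directions: $X_i$ is the value at the neighbouring vertex in direction $i$, $X_{ij}=X_{ji}$, etc. The vertices of an elementary $N$-cube are labelled by subsets $S\subseteq\{1,\dots,N\}$. 3D system: given seven $r$-planes $Y,Y_i,Y_j,Y_k,Y_{ij},Y_{ik},Y_{jk}$ in $\mathbb{P}^d$, $d\ge 4r+3$, with $\dim\operatorname{span}(Y,Y_a,Y_b,Y_{ab})=3r+2$ for each pair $a\ne b$ in $\{i,j,k\}$ and otherwise generic, there is a unique $r$-plane $Y_{ijk}$ with $\dim\operatorname{span}(Y_a,Y_{ab},Y_{ac},Y_{ijk})=3r+2$ for all $\{a,b,c\}=\{i,j,k\}$. The 3D system is the map assigning this $Y_{ijk}$ to the seven given $r$-planes; it is said to be defined at a septuple if such $Y_{ijk}$ exists and is unique. Generic initial data: let $\mathcal{P}_N$ be the set of tuples $(X,(X_i)_{1\le i\le N},(X_{ij})_{1\le i<j\le N})$ of $r$-planes in $\mathbb{P}^d$ such that $\dim\operatorname{span}(X,X_i,X_j,X_k)=4r+3$ for all pairwise distinct $i,j,k$ and $X_{ij}\subset\operatorname{span}(X,X_i,X_j)$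 for all $i<j$. ''For generic initial data'' means: for all data in some Zariski-open dense subset of $\mathcal{P}_N$ (in particular, the assertion includes that the 3D system is defined at all the septuples involved). *)

(* Defs.v *)
From HB Require Import structures.
From mathcomp Require Import all_boot all_order all_algebra.
From mathcomp Require Import reals.
From mathcomp Require mpoly.

Set Implicit Arguments.
Unset Strict Implicit.
Unset Printing Implicit Defensive.

Import GRing.Theory.
Local Open Scope ring_scope.

(* Points of P^d are the lines of R^(d+1).  An r-plane of P^d is a linear
   subspace of dimension r + 1, the span of projective subspaces is the sum of
   the corresponding linear subspaces, and "projective dimension m" always reads
   "\dim = m.+1". *)
Record grass (R : realType) (d r : nat) := Grass {
  plane :> {vspace 'rV[R]_d.+1};
  dim_plane : \dim plane == r.+1
}.

HB.instance Definition _ (R : realType) (d r : nat) :=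
  [isSub for @plane R d r].
HB.instance Definition _ (R : realType) (d r : nat) :=
  [Choice of grass R d r by <:].

Definition frame (R : realType) (d r : nat) (I : finType)
    (X : I -> grass R d r) (A : I -> 'M[R]_(r.+1, d.+1)) : Prop :=
  forall i, basis_of (X i) [seq row a (A i) | a : 'I_r.+1].

Definition entry_idx (d r : nat) (I : finType) : finType :=
  (I * 'I_r.+1 * 'I_d.+1)%type.

Definition entries (R : realType) (d r : nat) (I : finType)
    (A : I -> 'M[R]_(r.+1, d.+1)) : 'I_#|entry_idx d r I| -> R :=
  fun n => let p := enum_val n in A p.1.1 p.1.2 p.2.

(* Zero loci of sets of polynomials in the homogeneous (Stiefel) coordinates.
   As for homogeneous coordinates of a projective space, a polynomial vanishes
   at X when it vanishes at all representatives of X.  This is the quotient of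
   the Zariski topology of the tuples of matrices of full rank.  It is also the
   topology induced by the Pluecker and Segre embeddings, since the affine
   charts of a Grassmannian are polynomial sections of that quotient. *)
Definition zariski_closed (R : realType) (d r : nat) (I : finType)
    (Z : (I -> grass R d r) -> Prop) : Prop :=
  exists F : mpoly.mpoly #|entry_idx d r I| R -> Prop,
  forall X, Z X <->
    forall f, F f -> forall A, frame X A -> mpoly.meval (entries A) f = 0.

Definition zariski_open (R : realType) (d r : nat) (I : finType)
    (W : (I -> grass R d r) -> Prop) : Prop :=
  zariski_closed (fun X => ~ W X).

(* [Q] holds on the trace on [P] of a Zariski-open set [W], and this trace is
   dense in [P] for the induced topology. *)
Definition generically (R : realType) (d r : nat) (I : finType)
    (P Q : (I -> grass R d r) -> Prop) : Prop :=
  exists W : (I -> grass R d r) -> Prop,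
  [/\ zariski_open W,
      forall V, zariski_open V -> (exists X, P X /\ V X) ->
        exists X, [/\ P X, V X & W X]
    & forall X, P X -> W X -> Q X].

Section System3D.
Variables (R : realType) (d r : nat).

Definition qface (Y Ya Yb Yab : grass R d r) : Prop :=
  \dim (Y + Ya + Yb + Yab)%VS = (3 * r + 2).+1%N.

Definition completes (Yi Yj Yk Yij Yik Yjk Z : grass R d r) : Prop :=
  [/\ qface Yi Yij Yik Z, qface Yj Yij Yjk Z & qface Yk Yik Yjk Z].

(* The 3D system is defined at the seven planes, with value [Z]. *)
Definition system3D (Y Yi Yj Yk Yij Yik Yjk Z : grass R d r) : Prop :=
  [/\ qface Y Yi Yj Yij, qface Y Yi Yk Yik, qface Y Yj Yk Yjk
    & unique (completes Yi Yj Yk Yij Yik Yjk) Z].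

End System3D.

(* The vertices of the N-cube that carry initial data. *)
Definition init_vertex (N : nat) : finType := {S : {set 'I_N} | (#|S| <= 2)%N}.

Lemma card_v0 (N : nat) : (#|set0 : {set 'I_N}| <= 2)%N.
Proof. by rewrite cards0. Qed.

Lemma card_v1 (N : nat) (i : 'I_N) : (#|[set i]| <= 2)%N.
Proof. by rewrite cards1. Qed.

Lemma card_v2 (N : nat) (i j : 'I_N) : (#|[set i; j]| <= 2)%N.
Proof. by rewrite cards2; case: (i != j). Qed.

Definition v0 (N : nat) : init_vertex N := Sub set0 (card_v0 N).
Definition v1 (N : nat) (i : 'I_N) : init_vertex N := Sub [set i] (card_v1 i).
Definition v2 (N : nat) (i j : 'I_N) : init_vertex N :=
  Sub [set i; j] (card_v2 i j).

Definition initial_data (R : realType) (d r N : nat)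
    (X : init_vertex N -> grass R d r) : Prop :=
  (forall i j k : 'I_N, i != j -> i != k -> j != k ->
     \dim (X (v0 N) + X (v1 i) + X (v1 j) + X (v1 k))%VS = (4 * r + 3).+1%N) /\
  (forall i j : 'I_N, (i < j)%N ->
     (X (v2 i j) <= X (v0 N) + X (v1 i) + X (v1 j))%VS).

(* A family on all vertices of the N-cube that extends the data [X] and follows
   the 3D system on every 3-face. *)
Definition solution (R : realType) (d r N : nat)
    (X : init_vertex N -> grass R d r)
    (Y : {ffun {set 'I_N} -> grass R d r}) : Prop :=
  (forall s : init_vertex N, Y (val s) = X s) /\
  (forall (S : {set 'I_N}) (i j k : 'I_N),
     i \notin S -> j \notin S -> k \notin S ->
     i != j -> i != k -> j != k ->
     system3D (Y S) (Y (S :|: [set i])) (Y (S :|: [set j])) (Y (S :|: [set k]))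
       (Y (S :|: [set i; j])) (Y (S :|: [set i; k])) (Y (S :|: [set j; k]))
       (Y (S :|: [set i; j; k]))).

(* Main.v *)
From HB Require Import structures.
From mathcomp Require Import all_boot all_order all_algebra.
From mathcomp Require Import boolp reals.
From mathcomp Require Import mpoly.
From mathcomp Require Import ring zify.
Require Import Defs.

(** The proof replaces consistency around the cube by a closed formula.  Write
    [n] for [r + 1].  In a generic Q-net on the N-cube, all vertices of a facet
    of the cube span a common subspace, which has codimension [n] in the span
    of the whole net.  Conversely, choose for every direction [i] two linear
    maps [xi i false] and [xi i true] from a space [U] of dimension [(N + 1) n]
    onto a space of dimension [n], and put at the vertex [S] the common kernel
    of the maps [xi i (i \in S)].  A k-face of the cube then lies in the common
    kernel of [N - k] of these maps, a space of dimension [(k + 1) n], so any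
    such choice in general position gives a Q-net.  The same holds after a
    projection [pi] of [U] to the ambient space, as long as [pi] is injective
    on the spans of the 3-faces.  On a 3-face the three subspaces spanned by
    the far squares meet exactly in the image of the opposite vertex; this is
    the uniqueness that the 3D system asks for ([vertex_system3D]).
    All values of the net are thus given at once, and nothing is left to be
    compared ([exists_unique_solution]).

    Initial data fit this picture.  Let [U] be the space of [N + 1] blocks of
    size [n], and let [pi] send the blocks to combinations of frames of [X] and
    of the [X_i].  The facet through [X] in direction [i] is the vanishing of
    the i-th block, and the opposite facet is forced by the planes [X_ij]:
    block [0] equals the sum over [j != i] of block [j] times a matrix
    [slope i j], read off from the coordinates of a frame of [X_ij]
    ([facet_coef_row]).  So the theorem holds for initial data for which finitely
    many linear maps, with coefficients rational in the entries of the frames,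
    are injective ([transversal_solution]).

    It remains to see that this condition is open, dense and satisfiable.
    It is open because the minors that witness injectivity are rational
    functions, which is handled by a small calculus of functions
    that are rational near a point ([regular_solution], [near_solution]).  It is
    dense because the initial data are parametrized by the frames of [X],
    [X_i] and the coordinates of [X_ij]: a segment in the parameter space joins
    any initial data to a good one, and two nonzero polynomials on a line are
    both nonzero at some point ([initial_data_irreducible]).  It is satisfiable by
    an explicit net of polynomials: [U] consists of polynomials of degree at
    most [N], every [xi i e] is the evaluation at a point [node i e], and [pi]
    is the evaluation at four further points.  The vertex [S] is the monic
    polynomial with roots [node i (i \in S)], and every injectivity condition
    says that a polynomial of degree at most [N] with [N + 1] roots is zero
    ([model_transversal]). *)

Set Implicit Arguments.
Unset Strict Implicit.
Unset Printing Implicit Defensive.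

Import Order.TTheory GRing.Theory Num.Theory.
Local Open Scope ring_scope.

(** * Functions that are rational near a point *)

(** Polynomial functions enter only through these closure properties.  They
    are used for polynomials in the entries of a tuple of matrices and for
    polynomials along a line. *)
Record function_algebra (F : fieldType) (T : Type) := FunctionAlgebra {
  poly_fun :> (T -> F) -> Prop;
  poly_fun_const : forall c, poly_fun (fun=> c);
  poly_fun_add : forall f g,
    poly_fun f -> poly_fun g -> poly_fun (fun t => f t + g t);
  poly_fun_mul : forall f g,
    poly_fun f -> poly_fun g -> poly_fun (fun t => f t * g t)
}.

(** An alias that turns a proof of linearity into a canonical linear map. *)
Definition scalar_map (F : fieldType) (U : lmodType F) (f : U -> F)
  of scalar f : U -> F := f.
HB.instance Definition _ (F : fieldType) (U : lmodType F) (f : U -> F)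
    (lin_f : scalar f) :=
  GRing.isLinear.Build F U F _ (scalar_map lin_f) lin_f.

Section Germs.
Variables (F : fieldType) (T : Type) (alg : function_algebra F T) (t0 : T).

(** [P] holds on a basic Zariski-open neighbourhood of [t0]. *)
Definition near (P : T -> Prop) : Prop :=
  exists f, [/\ alg f, f t0 != 0 & forall t, f t != 0 -> P t].

Lemma near_true (P : T -> Prop) : (forall t, P t) -> near P.
Proof.
move=> allP; exists (fun=> 1); split=> [||t _]; [|exact: oner_neq0|exact: allP].
exact: poly_fun_const.
Qed.

Lemma near_and (P Q : T -> Prop) :
  near P -> near Q -> near (fun t => P t /\ Q t).
Proof.
move=> [f [algf f0 fP]] [g [algg g0 gQ]].
exists (fun t => f t * g t); split=> [||t]; first exact: poly_fun_mul.
  by rewrite mulf_neq0.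
by rewrite mulf_eq0 negb_or => /andP[/fP Pt /gQ Qt].
Qed.

Lemma near_mono (P Q : T -> Prop) :
  (forall t, P t -> Q t) -> near P -> near Q.
Proof. by move=> PQ [f [algf f0 fP]]; exists f; split=> // t /fP/PQ. Qed.

Lemma near_and_mono (P Q P' : T -> Prop) :
  near P -> near Q -> (forall t, P t -> Q t -> P' t) -> near P'.
Proof.
by move=> nP nQ PQ; apply: near_mono (near_and nP nQ) => t [Pt Qt]; apply: PQ.
Qed.

Lemma near_at (P : T -> Prop) : near P -> P t0.
Proof. by case=> f [_ f0 fP]; apply: fP. Qed.

Lemma near_seq (I : eqType) (s : seq I) (P : I -> T -> Prop) :
  (forall i, near (P i)) -> near (fun t => {in s, forall i, P i t}).
Proof.
move=> nP; elim: s => [|i s IH]; first by apply: near_true => t i.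
apply: near_and_mono (nP i) IH _ => t Pi Ps j.
by rewrite inE => /predU1P[->|/Ps].
Qed.

Lemma near_forall (I : finType) (P : I -> T -> Prop) :
  (forall i, near (P i)) -> near (fun t => forall i, P i t).
Proof.
move=> nP; apply: near_mono (near_seq (enum I) nP) => t Pt i.
by apply: Pt; rewrite mem_enum.
Qed.

Lemma near_imply (b : bool) (P : T -> Prop) :
  (b -> near P) -> near (fun t => b -> P t).
Proof.
case: b => [nP|_]; last exact: near_true.
by apply: near_mono (nP isT).
Qed.

(** Membership in the local ring of [t0], up to germs. *)
Definition regular (f : T -> F) : Prop :=
  exists p q, [/\ alg p, alg q, q t0 != 0
    & forall t, q t != 0 -> f t = p t / q t].

Lemma regular_poly f : alg f -> regular f.
Proof.
move=> algf; exists f, (fun=> 1); split=> //; first exact: poly_fun_const.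
  exact: oner_neq0.
by move=> t _; rewrite divr1.
Qed.

Lemma regular_const c : regular (fun=> c).
Proof. exact/regular_poly/poly_fun_const. Qed.

Lemma regular_ext f g : (forall t, f t = g t) -> regular f -> regular g.
Proof.
by move=> fg [p [q [? ? ? fE]]]; exists p, q; split=> // t /fE; rewrite fg.
Qed.

Lemma regular_add f g :
  regular f -> regular g -> regular (fun t => f t + g t).
Proof.
move=> [p [q [algp algq q0 fE]]] [p' [q' [algp' algq' q'0 gE]]].
exists (fun t => p t * q' t + p' t * q t), (fun t => q t * q' t); split.
- by apply: poly_fun_add; apply: poly_fun_mul.
- exact: poly_fun_mul.
- by rewrite mulf_neq0.
- move=> t; rewrite mulf_eq0 negb_or => /andP[qt q't].
  by rewrite fE // gE // addf_div.
Qed.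

Lemma regular_mul f g :
  regular f -> regular g -> regular (fun t => f t * g t).
Proof.
move=> [p [q [algp algq q0 fE]]] [p' [q' [algp' algq' q'0 gE]]].
exists (fun t => p t * p' t), (fun t => q t * q' t); split.
- exact: poly_fun_mul.
- exact: poly_fun_mul.
- by rewrite mulf_neq0.
- move=> t; rewrite mulf_eq0 negb_or => /andP[qt q't].
  by rewrite fE // gE // mulf_div.
Qed.

Lemma regular_opp f : regular f -> regular (fun t => - f t).
Proof.
move=> rf; apply: (regular_ext (f := fun t => -1 * f t)) => [t|].
  by rewrite mulN1r.
exact/regular_mul/rf/regular_const.
Qed.

Lemma regular_sum (I : Type) (s : seq I) (P : pred I) (f : I -> T -> F) :
  (forall i, P i -> regular (f i)) ->
  regular (fun t => \sum_(i <- s | P i) f i t).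
Proof.
move=> rf; elim: s => [|i s IH].
  by apply: (regular_ext (f := fun=> 0)) (regular_const 0) => t; rewrite big_nil.
case Pi: (P i).
  apply: regular_ext (regular_add (rf i Pi) IH) => t.
  by rewrite big_cons Pi.
by apply: regular_ext IH => t; rewrite big_cons Pi.
Qed.

Lemma regular_prod (I : Type) (s : seq I) (f : I -> T -> F) :
  (forall i, regular (f i)) -> regular (fun t => \prod_(i <- s) f i t).
Proof.
move=> rf; elim: s => [|i s IH].
  by apply: (regular_ext (f := fun=> 1)) (regular_const 1) => t; rewrite big_nil.
by apply: regular_ext (regular_mul (rf i) IH) => t; rewrite big_cons.
Qed.

Lemma near_neq0 f : regular f -> f t0 != 0 -> near (fun t => f t != 0).
Proof.
move=> [p [q [algp algq q0 fE]]]; rewrite fE // mulf_eq0 negb_or => /andP[p0 _].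
exists (fun t => p t * q t); split; first exact: poly_fun_mul.
  by rewrite mulf_neq0.
move=> t; rewrite mulf_eq0 negb_or => /andP[pt qt].
by rewrite fE // mulf_neq0 // invr_neq0.
Qed.

Lemma regular_inv f : regular f -> f t0 != 0 -> regular (fun t => (f t)^-1).
Proof.
move=> [p [q [algp algq q0 fE]]]; rewrite fE // mulf_eq0 negb_or => /andP[p0 _].
exists (fun t => q t * q t), (fun t => p t * q t); split.
- exact: poly_fun_mul.
- exact: poly_fun_mul.
- by rewrite mulf_neq0.
- move=> t; rewrite mulf_eq0 negb_or => /andP[pt qt].
  by rewrite fE // invf_div -mulf_div divff // mulr1.
Qed.

Definition regular_mx m n (A : T -> 'M[F]_(m, n)) : Prop :=
  forall i j, regular (fun t => A t i j).

Lemma regular_mx_const m n (A : 'M[F]_(m, n)) : regular_mx (fun=> A).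
Proof. by move=> i j; apply: regular_const. Qed.

Lemma regular_mulmx m n p (A : T -> 'M[F]_(m, n)) (B : T -> 'M[F]_(n, p)) :
  regular_mx A -> regular_mx B -> regular_mx (fun t => A t *m B t).
Proof.
move=> rA rB i j.
apply: (regular_ext (f := fun t => \sum_k A t i k * B t k j)) => [t|].
  by rewrite mxE.
by apply: regular_sum => k _; apply: regular_mul.
Qed.

Lemma regular_det n (A : T -> 'M[F]_n) :
  regular_mx A -> regular (fun t => \det (A t)).
Proof.
move=> rA; apply: regular_sum => s _; apply: regular_mul.
  exact: regular_const.
by apply: regular_prod => i; apply: rA.
Qed.

Lemma near_unitmx n (A : T -> 'M[F]_n) :
  regular_mx A -> A t0 \in unitmx -> near (fun t => A t \in unitmx).
Proof.
move=> rA; rewrite unitmxE unitfE => detA.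
apply: near_mono (near_neq0 (regular_det rA) detA) => t.
by rewrite unitmxE unitfE.
Qed.

(** Cramer's rule. *)
Lemma regular_invmx n (A : T -> 'M[F]_n) :
  regular_mx A -> A t0 \in unitmx -> regular_mx (fun t => invmx (A t)).
Proof.
move=> rA uA i j.
have detA : \det (A t0) != 0 by rewrite -unitfE -unitmxE.
have [p [q [algp algq q0 detE]]] := regular_inv (regular_det rA) detA.
have [h [algh h0 hP]] := near_unitmx rA uA.
have: regular (fun t => (\det (A t))^-1 * cofactor (A t) j i).
  apply: regular_mul; first exact/regular_inv/detA/regular_det.
  apply: regular_mul; first exact: regular_const.
  apply: regular_det => a b.
  by apply: (regular_ext (f := fun t => A t (lift j a) (lift i b))) => // t;
    rewrite !mxE.
move=> [p' [q' [algp' algq' q'0 E]]].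
exists (fun t => p' t * h t), (fun t => q' t * h t); split.
- exact: poly_fun_mul.
- exact: poly_fun_mul.
- by rewrite mulf_neq0.
- move=> t; rewrite mulf_eq0 negb_or => /andP[q't ht].
  rewrite -mulf_div divff // mulr1 -E // /invmx hP // !mxE.
  by [].
Qed.

(** A system whose only solution at [t0] is zero has a left inverse [E] there;
    its composite with the system at [t] is a square system, invertible near
    [t0], and Cramer's rule expresses any solution as a rational function. *)
Lemma regular_solution (U : vectType F) (K : finType)
    (Phi : T -> K -> U -> F) (b : T -> K -> F) :
  (forall t k, scalar (Phi t k)) ->
  (forall k u, regular (fun t => Phi t k u)) ->
  (forall k, regular (fun t => b t k)) ->
  (forall u, (forall k, Phi t0 k u = 0) -> u = 0) ->
  exists s : T -> U,
    (forall l : U -> F, scalar l -> regular (fun t => l (s t))) /\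
    near (fun t => forall u, (forall k, Phi t k u = b t k) -> u = s t).
Proof.
move=> linPhi rPhi rb inj.
pose n := \dim {: U}; pose e := vbasis {: U}.
pose vec (x : 'rV[F]_n) : U := \sum_i x 0 i *: e`_i.
have vecP u : exists x, u = vec x.
  exists (\row_i coord e i u); rewrite /vec.
  rewrite [LHS](coord_vbasis (memvf u)).
  by apply: eq_bigr => i _; rewrite mxE.
have vec_inj x : vec x = 0 -> x = 0.
  move=> /(freeP (basis_free (vbasisP fullv))) x0.
  by apply/rowP => i; rewrite x0 mxE.
pose A t : 'M[F]_(n, #|K|) := \matrix_(i, k) Phi t (enum_val k) e`_i.
pose B t : 'rV[F]_#|K| := \row_k b t (enum_val k).
have APhi t x k : (x *m A t) 0 k = Phi t (enum_val k) (vec x).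
  rewrite !mxE /vec -[RHS]/(scalar_map (linPhi _ _) _) linear_sum.
  by apply: eq_bigr => i _; rewrite mxE linearZ.
have rA : regular_mx A.
  move=> i k; apply: (regular_ext (f := fun t => Phi t (enum_val k) e`_i)) => //.
  by move=> t; rewrite mxE.
have rB : regular_mx B.
  by move=> i k; apply: regular_ext (rb (enum_val k)) => t; rewrite mxE.
(* The rows of the kernel of [A t0] are coordinates of solutions at [t0]. *)
have free0 : row_free (A t0).
  rewrite -kermx_eq0; apply/eqP/row_matrixP => i; rewrite row0.
  apply: vec_inj; apply: inj => k; rewrite -(enum_rankK k) -APhi -row_mul.
  by rewrite mulmx_ker row0 mxE.
(* [E] is a left inverse of the system at [t0], which stays fixed below. *)
have [E AE] := row_freeP free0.
have rAE : regular_mx (fun t => A t *m E).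
  exact/regular_mulmx/regular_mx_const/rA.
have uAE : A t0 *m E \in unitmx by rewrite AE unitmx1.
exists (fun t => vec (B t *m E *m invmx (A t *m E))); split.
  move=> l lin_l; apply: (regular_ext
    (f := fun t => \sum_i (B t *m E *m invmx (A t *m E)) 0 i * l e`_i)) => [t|].
    rewrite -[RHS]/(scalar_map lin_l _) linear_sum.
    by apply: eq_bigr => i _; rewrite linearZ.
  apply: regular_sum => i _; apply: regular_mul; last exact: regular_const.
  apply: regular_mulmx; last exact: regular_invmx.
  exact/regular_mulmx/regular_mx_const/rB.
apply: near_mono (near_unitmx rAE uAE) => t ut u uE.
have [x ux] := vecP u.
have xA : x *m A t = B t.
  by apply/rowP => k; rewrite APhi -ux uE mxE.
by rewrite ux -xA -(mulmxA x) mulmxK.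
Qed.

(** An injective linear system has only the solution zero; near [t0] this
    solution is unique, because it is the rational one. *)
Lemma near_injective (U : vectType F) (K : finType)
    (Phi : T -> K -> U -> F) :
  (forall t k, scalar (Phi t k)) ->
  (forall k u, regular (fun t => Phi t k u)) ->
  (forall u, (forall k, Phi t0 k u = 0) -> u = 0) ->
  near (fun t => forall u, (forall k, Phi t k u = 0) -> u = 0).
Proof.
move=> linPhi rPhi inj.
have [s [_ ns]] := regular_solution linPhi rPhi (fun k => regular_const 0) inj.
apply: near_mono ns => t st u u0; rewrite (st u u0).
by symmetry; apply: st => k; rewrite -[LHS]/(scalar_map (linPhi t k) 0) linear0.
Qed.

End Germs.

(** * Nets cut out by facets *)

Lemma grass_dim (R : realType) (d r : nat) (X : grass R d r) :
  \dim X = r.+1.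
Proof. exact/eqP/dim_plane. Qed.

(** Planes of equal dimension are comparable only if equal. *)
Lemma grass_eq (R : realType) (d r : nat) (X Y : grass R d r) :
  (X <= Y)%VS -> X = Y.
Proof.
by move=> XY; apply: val_inj; apply/eqP; rewrite eqEdim XY !grass_dim leqnn.
Qed.

Section Uniqueness.
Variables (R : realType) (d r N : nat).

(** A vertex with at least three elements is the eighth vertex of a 3-face whose
    other seven vertices are smaller, so the 3D system propagates the initial
    values by induction on the size of the vertex. *)
Lemma solution_unique (X : init_vertex N -> grass R d r)
    (Y Y' : {ffun {set 'I_N} -> grass R d r}) :
  solution X Y -> solution X Y' -> Y = Y'.
Proof.
move=> [Y2 Y3] [Y'2 Y'3]; apply/ffunP => S.
have [m] := ubnP #|S|; elim: m S => // m IH S; rewrite ltnS => leSm.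
have [leS2|] := leqP #|S| 2.
  by have := Y'2 (Sub S leS2); rewrite -(Y2 (Sub S leS2)) SubK.
move=> /card_gt2P[i [j [k [[Si Sj Sk] [ij jk ki]]]]].
set S0 := S :\: [set i; j; k].
have SE : S0 :|: [set i; j; k] = S.
  apply/setP => l; rewrite !inE.
  by do 3![case: eqVneq => [->|_] //=; rewrite ?orbT ?Si ?Sj ?Sk //];
    rewrite orbF.
have nS0 l : l \in [set i; j; k] -> l \notin S0 by rewrite !inE => ->.
have ltS (B : {set 'I_N}) l : l \in S -> l \notin S0 :|: B ->
    B \subset [set i; j; k] -> Y (S0 :|: B) = Y' (S0 :|: B).
  move=> Sl lB BS; apply: IH; apply: leq_trans leSm; apply: proper_card.
  rewrite properE -{1}SE setUS //=; apply/subsetPn; exists l => //.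
have [i0 j0 k0] : [/\ i \notin S0, j \notin S0 & k \notin S0].
  by split; apply: nS0; rewrite !inE eqxx ?orbT.
have ik : i != k by rewrite eq_sym.
have [_ _ _ [_ uniq_Y]] := Y3 S0 i j k i0 j0 k0 ij ik jk.
have [_ _ _ [comp_Y' _]] := Y'3 S0 i j k i0 j0 k0 ij ik jk.
rewrite -SE; apply: uniq_Y; move: comp_Y'.
have notin l (B : {set 'I_N}) : l \notin S0 -> l \notin B -> l \notin S0 :|: B.
  by rewrite in_setU negb_or => -> ->.
have sub1 l : l \in [set i; j; k] -> [set l] \subset [set i; j; k].
  by rewrite sub1set.
have sub2 l l' : l \in [set i; j; k] -> l' \in [set i; j; k] ->
    [set l; l'] \subset [set i; j; k].
  by move=> hl hl'; apply/subsetP => x; rewrite in_set2 => /orP[]/eqP->.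
have [hi hj hk] : [/\ i \in [set i; j; k], j \in [set i; j; k]
    & k \in [set i; j; k]] by rewrite !inE !eqxx ?orbT.
have [ji kj] : j != i /\ k != j by split; rewrite eq_sym.
rewrite (ltS [set i] j) ?(ltS [set j] i) ?(ltS [set k] i)
  ?(ltS [set i; j] k) ?(ltS [set i; k] j) ?(ltS [set j; k] i) //;
  solve [exact: sub1 | exact: sub2
    | by apply: notin; rewrite ?in_set1 ?in_set2 ?negb_or // ?ij ?ik ?jk ?ji ?ki ?kj].
Qed.

End Uniqueness.

Section Cube.
Variables (R : realType) (d r N : nat) (U : vectType R).
Variables (xi : 'I_N -> bool -> 'Hom(U, 'rV[R]_r.+1)).
Variables (pi : 'Hom(U, 'rV[R]_d.+1)).

(** For [Z] the set of fixed directions and [S] a vertex, this is the span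
    of the face of the cube through [S] in the directions outside [Z]. *)
Definition flat (Z S : {set 'I_N}) : {vspace U} :=
  (\bigcap_(l in Z) lker (xi l (l \in S)))%VS.

Lemma mem_flat (Z S : {set 'I_N}) u :
  reflect (forall l, l \in Z -> xi l (l \in S) u = 0) (u \in flat Z S).
Proof.
rewrite memvE; apply: (iffP subv_bigcapP) => h l /h; rewrite -memvE memv_ker.
  by move/eqP.
by move=> ->.
Qed.

Lemma eq_flat (Z S S' : {set 'I_N}) :
  {in Z, S =i S'} -> flat Z S = flat Z S'.
Proof. by move=> SS'; apply: eq_bigr => l /SS' ->. Qed.

Lemma flat_anti (Z Z' S : {set 'I_N}) :
  Z \subset Z' -> (flat Z' S <= flat Z S)%VS.
Proof.
move=> /subsetP ZZ'; apply/subvP => u /mem_flat h; apply/mem_flat => l /ZZ'.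
exact: h.
Qed.

Lemma flatU (Z Z' S : {set 'I_N}) :
  flat (Z :|: Z') S = (flat Z S :&: flat Z' S)%VS.
Proof.
apply/vspaceP => u; rewrite memv_cap; apply/mem_flat/andP.
  by move=> h; split; apply/mem_flat => l hl; apply: h; rewrite inE hl ?orbT.
by move=> [/mem_flat h /mem_flat h'] l; rewrite inE => /orP[/h|/h'].
Qed.

Lemma dim_cap_lker (A : {vspace U}) (f : 'Hom(U, 'rV[R]_r.+1)) :
  (\dim A <= \dim (A :&: lker f) + r.+1)%N.
Proof.
rewrite -(limg_ker_dim f A) leq_add2l.
by apply: leq_trans (dimvS (subvf _)) _; rewrite dimvf /dim /= mul1n.
Qed.

Lemma dim_cap_flat (A : {vspace U}) (Z S : {set 'I_N}) :
  (\dim A <= \dim (A :&: flat Z S) + #|Z| * r.+1)%N.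
Proof.
rewrite /flat -big_enum cardE; elim: (enum Z) => [|l s IH].
  by rewrite big_nil capvf addn0.
rewrite big_cons capvA (capvC A) -capvA capvC; apply: (leq_trans IH).
rewrite /= mulSn addnA leq_add2r; exact: dim_cap_lker.
Qed.

Hypothesis N_gt2 : (2 < N)%N.
Hypothesis dimU : \dim {: U} = (N.+1 * r.+1)%N.
Hypothesis indep : forall (S : {set 'I_N}) j,
  (flat setT S :&: lker (xi j (j \notin S)) = 0)%VS.
Hypothesis pi_inj : forall Z S : {set 'I_N}, #|~: Z| = 3%N ->
  (flat Z S :&: lker pi = 0)%VS.

(** Each of the maps cuts the dimension by at most [n].  The total drop from
    [U] to zero along [N + 1] independent maps is [(N + 1) n], so every step
    cuts by exactly [n]. *)
Lemma dim_flat (Z S : {set 'I_N}) :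
  \dim (flat Z S) = ((N.+1 - #|Z|) * r.+1)%N.
Proof.
have leZ : (#|Z| <= N)%N by rewrite -[leqRHS]card_ord max_card.
apply/eqP; rewrite eqn_leq; apply/andP; split.
  have j : 'I_N by exact: Ordinal (ltnW (ltnW N_gt2)).
  apply: leq_trans (dim_cap_flat _ (~: Z) S) _; rewrite -flatU setUCr.
  apply: leq_trans (leq_add (dim_cap_lker _ (xi j (j \notin S))) (leqnn _)) _.
  rewrite indep dimv0 add0n -mulSn leq_mul2r; apply/orP; right.
  by rewrite cardsCs setCK card_ord -subSn.
have := dim_cap_flat fullv Z S; rewrite capfv dimU.
by rewrite mulnBl leq_subLR addnC.
Qed.

Lemma pi_inj_flat (Z S : {set 'I_N}) i j k :
  i != j -> i != k -> j != k -> ~: [set i; j; k] \subset Z ->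
  (flat Z S :&: lker pi = 0)%VS.
Proof.
move=> ij ik jk ZT; apply/eqP; rewrite -subv0.
rewrite -(@pi_inj (~: [set i; j; k]) S).
  by apply: capvS => //; apply: flat_anti.
by rewrite setCK -setUA cardsU1 cards2 !inE negb_or ij ik jk.
Qed.

Lemma dim_vertex S : \dim (pi @: flat setT S) == r.+1.
Proof.
rewrite limg_dim_eq ?dim_flat ?cardsT ?card_ord ?subSnn ?mul1n //.
pose o k (hk : (k < 3)%N) : 'I_N := Ordinal (leq_trans hk N_gt2).
by apply: (@pi_inj_flat _ _ (o 0%N isT) (o 1%N isT) (o 2 isT));
  rewrite ?subsetT.
Qed.

Definition vertex S : grass R d r := Grass (dim_vertex S).

(** The maps [xi i false] and [xi i true] vanish together on no nonzero vector of
    an edge, so adjacent vertices are independent; counting dimensions, three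
    vertices already span the square. *)
Lemma square_span (S : {set 'I_N}) i j :
  i \notin S -> j \notin S -> i != j ->
  flat (~: [set i; j]) S =
  (flat setT S + flat setT (S :|: [set i]) + flat setT (S :|: [set j]))%VS.
Proof.
move=> iS jS ij; apply/esym/eqP; rewrite eqEdim; apply/andP; split.
  rewrite !subv_add; apply/andP; split; first (apply/andP; split).
  - exact/flat_anti/subsetT.
  - rewrite (@eq_flat _ S (S :|: [set i])); first exact/flat_anti/subsetT.
    by move=> l; rewrite !inE negb_or => /andP[/negPf-> _]; rewrite orbF.
  - rewrite (@eq_flat _ S (S :|: [set j])); first exact/flat_anti/subsetT.
    by move=> l; rewrite !inE negb_or => /andP[_ /negPf->]; rewrite orbF.
have dimT B : \dim (flat setT B) = r.+1.
  by rewrite dim_flat cardsT card_ord subSnn mul1n.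
rewrite !dimv_disjoint_sum ?dimT.
- rewrite dim_flat; have := cardsC [set i; j]; rewrite cards2 ij card_ord; nia.
- apply/eqP; rewrite -subv0 -(indep S i) capvS //.
  apply/subvP => u /mem_flat h; rewrite memv_ker iS; apply/eqP.
  by have := h i; rewrite !inE eqxx orbT; apply.
apply/eqP; rewrite -subv0 -(indep (S :|: [set j]) j) capvC capvS //.
rewrite !inE eqxx orbT subv_add /=.
apply/andP; split; apply/subvP => u /mem_flat h; rewrite memv_ker; apply/eqP.
  by have := h j; rewrite !inE (negPf jS); apply.
by have := h j; rewrite !inE (negPf jS) eq_sym (negPf ij); apply.
Qed.

Lemma vertex_square (S : {set 'I_N}) i j :
  i \notin S -> j \notin S -> i != j ->
  (vertex S + vertex (S :|: [set i]) + vertex (S :|: [set j]))%VS =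
  (pi @: flat (~: [set i; j]) S)%VS.
Proof. by move=> iS jS ij; rewrite square_span // !limgD. Qed.

Lemma dim_square (S : {set 'I_N}) i j k :
  i != j -> i != k -> j != k ->
  \dim (pi @: flat (~: [set i; j]) S) = (3 * r + 2).+1%N.
Proof.
move=> ij ik jk; rewrite limg_dim_eq; last first.
  apply: (pi_inj_flat _ ij ik jk); rewrite setCS; apply/subsetP => l.
  by rewrite !inE => /orP[]->; rewrite ?orbT.
rewrite dim_flat; have := cardsC [set i; j]; rewrite cards2 ij card_ord; nia.
Qed.

Lemma qface_vertex (S : {set 'I_N}) i j k :
  i \notin S -> j \notin S -> i != j -> i != k -> j != k ->
  qface (vertex S) (vertex (S :|: [set i])) (vertex (S :|: [set j]))
    (vertex (S :|: [set i; j])).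
Proof.
move=> iS jS ij ik jk; rewrite /qface vertex_square //.
rewrite (addv_idPl _) ?(dim_square _ ij ik jk) //= limgS //.
rewrite (@eq_flat _ S (S :|: [set i; j])); first exact/flat_anti/subsetT.
by move=> l; rewrite !inE => /negPf->; rewrite orbF.
Qed.

Lemma qface_sub (S : {set 'I_N}) i j k (Z : grass R d r) :
  i \notin S -> j \notin S -> i != j -> i != k -> j != k ->
  qface (vertex S) (vertex (S :|: [set i])) (vertex (S :|: [set j])) Z ->
  (Z <= pi @: flat (~: [set i; j]) S)%VS.
Proof.
move=> iS jS ij ik jk; rewrite /qface vertex_square // => dimZ.
suff /eqP -> : (pi @: flat (~: [set i; j]) S)%VS ==
    (pi @: flat (~: [set i; j]) S + Z)%VS by exact: addvSr.
by rewrite eqEdim addvSl dimZ (dim_square _ ij ik jk) leqnn.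
Qed.

(** A plane completing the seven others lies in the images of three squares.
    Since [pi] is injective on the 3-face, the intersection of the images is the
    image of the intersection, which is the eighth vertex. *)
Lemma vertex_system3D (S : {set 'I_N}) i j k :
  i \notin S -> j \notin S -> k \notin S -> i != j -> i != k -> j != k ->
  system3D (vertex S) (vertex (S :|: [set i])) (vertex (S :|: [set j]))
    (vertex (S :|: [set k])) (vertex (S :|: [set i; j]))
    (vertex (S :|: [set i; k])) (vertex (S :|: [set j; k]))
    (vertex (S :|: [set i; j; k])).
Proof.
move=> iS jS kS ij ik jk.
have [ji ki kj] : [/\ j != i, k != i & k != j] by split; rewrite eq_sym.
have notinU l m : l \notin S -> l != m -> l \notin S :|: [set m].
  by rewrite !inE negb_or => -> ->.
have Uij : S :|: [set i; j] = S :|: [set i] :|: [set j] by rewrite setUA.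
have Uji : S :|: [set i; j] = S :|: [set j] :|: [set i] by rewrite Uij setUAC.
have Uik : S :|: [set i; k] = S :|: [set i] :|: [set k] by rewrite setUA.
have Uki : S :|: [set i; k] = S :|: [set k] :|: [set i] by rewrite Uik setUAC.
have Ujk : S :|: [set j; k] = S :|: [set j] :|: [set k] by rewrite setUA.
have Ukj : S :|: [set j; k] = S :|: [set k] :|: [set j] by rewrite Ujk setUAC.
have [Ui Uj Uk] : [/\ S :|: [set i; j; k] = S :|: [set i] :|: [set j; k],
    S :|: [set i; j; k] = S :|: [set j] :|: [set i; k]
    & S :|: [set i; j; k] = S :|: [set k] :|: [set i; j]].
  by split; apply/setP => l; rewrite !inE;
    case: (l \in S); case: (l == i); case: (l == j); case: (l == k).
split; [exact: (qface_vertex iS jS ij ik jk)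
  | exact: (qface_vertex iS kS ik ij kj)
  | exact: (qface_vertex jS kS jk ji ki)|].
split.
  split.
  - rewrite Ui Uij Uik.
    exact: (qface_vertex (notinU _ _ jS ji) (notinU _ _ kS ki) jk ji ki).
  - rewrite Uj Uji Ujk.
    exact: (qface_vertex (notinU _ _ iS ij) (notinU _ _ kS kj) ik ij kj).
  - rewrite Uk Uki Ukj.
    exact: (qface_vertex (notinU _ _ iS ik) (notinU _ _ jS jk) ij ik jk).
move=> Z [Zi Zj Zk]; apply/esym/grass_eq/subvP => v Zv.
(* [Z] lies in the span of each of the three far squares. *)
have {Zi} : v \in (pi @: flat (~: [set j; k]) (S :|: [set i]))%VS.
  apply: subvP Zv; move: Zi; rewrite Uij Uik.
  exact: (qface_sub (notinU _ _ jS ji) (notinU _ _ kS ki) jk ji ki).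
have {Zj} : v \in (pi @: flat (~: [set i; k]) (S :|: [set j]))%VS.
  apply: subvP Zv; move: Zj; rewrite Uji Ujk.
  exact: (qface_sub (notinU _ _ iS ij) (notinU _ _ kS kj) ik ij kj).
have {Zk} : v \in (pi @: flat (~: [set i; j]) (S :|: [set k]))%VS.
  apply: subvP Zv; move: Zk; rewrite Uki Ukj.
  exact: (qface_sub (notinU _ _ iS ik) (notinU _ _ jS jk) ij ik jk).
move=> /memv_imgP[uk Luk ->] /memv_imgP[uj Luj ej] /memv_imgP[ui Lui ei].
pose L := flat (~: [set i; j; k]) S.
have sub_L (l m p : 'I_N) u : [set l; m; p] = [set i; j; k] ->
    u \in flat (~: [set m; p]) (S :|: [set l]) -> u \in L.
  move=> e /mem_flat h; rewrite /L -e; apply/mem_flat => q; rewrite !inE !negb_or.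
  move=> /andP[/andP[ql qm] qp].
  by have := h q; rewrite !inE negb_or qm qp (negPf ql) orbF; apply.
(* Hence the three preimages of [v] coincide. *)
have inj u w : u \in L -> w \in L -> pi u = pi w -> u = w.
  move=> Lu Lw uw; apply/eqP; rewrite -subr_eq0 -memv0.
  rewrite -(pi_inj_flat S ij ik jk (subxx _)) memv_cap memvB //=.
  by rewrite memv_ker linearB /= uw subrr.
have Lk : uk \in L by apply: sub_L Luk; rewrite [RHS]setUC setUA.
have eqj : uj = uk by apply: inj (esym ej) => //; apply: sub_L Luj;
  rewrite (setUC [set j]).
have eqi : ui = uk by apply: inj (esym ei) => //; apply: sub_L Lui.
move: Lui Luj; rewrite eqi eqj => /mem_flat hi /mem_flat hj.
move/mem_flat: Luk => hk; apply: memv_img; apply/mem_flat => l _.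
have [->|li] := eqVneq l i.
  by have := hi i; rewrite !inE !eqxx !orbT /= negb_or ij ik; apply.
have [->|lj] := eqVneq l j.
  by have := hj j; rewrite !inE !eqxx !orbT /= negb_or ji jk; apply.
have [->|lk] := eqVneq l k.
  by have := hk k; rewrite !inE !eqxx !orbT /= negb_or ki kj; apply.
have := hi l; rewrite !inE negb_or lj lk (negPf li) (negPf lj) (negPf lk) /=.
by rewrite !orbF; apply.
Qed.

Lemma exists_unique_solution (X : init_vertex N -> grass R d r) :
  (forall s, X s <= pi @: flat setT (val s))%VS ->
  exists! Y : {ffun {set 'I_N} -> grass R d r}, solution X Y.
Proof.
move=> subX; exists [ffun S => vertex S].
have sol : solution X [ffun S => vertex S].
  split=> [s|S i j k iS jS kS ij ik jk]; rewrite !ffunE.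
    exact/esym/grass_eq.
  exact: vertex_system3D.
by split=> // Y; apply: solution_unique.
Qed.

End Cube.

(** * Frames and block coordinates *)

Section Frames.
Variables (R : realType) (d r : nat).

Lemma memv_rows m (A : 'M[R]_(m, d.+1)) v :
  v \in <<[seq row a A | a : 'I_m]>>%VS <-> exists u : 'rV_m, v = u *m A.
Proof.
rewrite span_def big_map big_enum; split.
  move=> /memv_sumP[vs vsP ->].
  have [k kP] : exists k : 'I_m -> R, forall a, vs a = k a *: row a A.
    apply: (@fin_all_exists _ (fun=> R) (fun a c => vs a = c *: row a A)) => a.
    exact/vlineP/vsP.
  exists (\row_a k a); rewrite mulmx_sum_row.
  by apply: eq_bigr => a _; rewrite mxE kP.
move=> [u ->]; rewrite mulmx_sum_row; apply: memv_suml => a _.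
by apply: (subvP (sumv_sup a _ (subvv _))) => //; apply/memvZ/memv_line.
Qed.

Lemma free_rows m (A : 'M[R]_(m, d.+1)) :
  free [seq row a A | a : 'I_m] <-> (forall u : 'rV_m, u *m A = 0 -> u = 0).
Proof.
have -> : [seq row a A | a : 'I_m] = [tuple of map (fun a => row a A) (ord_tuple m)].
  by rewrite /image_mem -val_ord_tuple.
have nthE (a : 'I_m) : [tuple of map (fun a => row a A) (ord_tuple m)]`_a = row a A.
  by rewrite -tnth_nth tnth_map tnth_ord_tuple.
split=> [/freeP fA u uA|inj]; last apply/freeP => k k0 a.
  apply/rowP => a; rewrite mxE; apply: fA a; rewrite -[RHS]uA mulmx_sum_row.
  by apply: eq_bigr => a _; rewrite nthE.
have /rowP/(_ a) : \row_a k a = 0; last by rewrite !mxE.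
apply: inj; rewrite mulmx_sum_row -[RHS]k0.
by apply: eq_bigr => b _; rewrite nthE mxE.
Qed.

Variable I : finType.

Lemma mem_frame (X : I -> grass R d r) A s v : frame X A ->
  v \in plane (X s) <-> exists u : 'rV_r.+1, v = u *m A s.
Proof. by move=> /(_ s)/andP[/eqP <- _]; apply: memv_rows. Qed.

Lemma frame_inj (X : I -> grass R d r) A s (u : 'rV_r.+1) :
  frame X A -> u *m A s = 0 -> u = 0.
Proof. by move=> /(_ s)/andP[_ /free_rows]; apply. Qed.

Lemma frame_exists (A : I -> 'M[R]_(r.+1, d.+1)) :
  (forall s (u : 'rV_r.+1), u *m A s = 0 -> u = 0) ->
  exists X : I -> grass R d r, frame X A.
Proof.
move=> inj.
have free_A s : free [seq row a (A s) | a : 'I_r.+1] by apply/free_rows/inj.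
have dim_A s : \dim <<[seq row a (A s) | a : 'I_r.+1]>> == r.+1.
  by have /eqP-> := free_A s; rewrite size_map size_enum_ord.
by exists (fun s => Grass (dim_A s)) => s; apply/andP.
Qed.

End Frames.

Section Coordinates.
Variables (R : realType) (d r N : nat).
Local Notation n := r.+1.
Local Notation U := {ffun option 'I_N -> 'rV[R]_n}.
Local Notation frames := (init_vertex N -> 'M[R]_(n, d.+1)).
Local Notation base_frames := (option 'I_N -> 'M[R]_(n, d.+1)).
Local Notation coefs := (init_vertex N -> option 'I_N -> 'M[R]_n).
Local Notation slopes := ('I_N -> 'I_N -> 'M[R]_n).

(** The vertices of the cube whose planes serve as blocks of coordinates:
    [None] is the origin and [Some i] its neighbour in direction [i]. *)
Definition base (o : option 'I_N) : init_vertex N :=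
  if o is Some i then v1 i else v0 N.

Definition point (B : base_frames) (v : U) : 'rV[R]_d.+1 :=
  \sum_o v o *m B o.

Fact point_is_linear B : linear (point B).
Proof.
move=> c u v; rewrite /point scaler_sumr -big_split; apply: eq_bigr => o _.
by rewrite !ffunE mulmxDl scalemxAl.
Qed.
HB.instance Definition _ B := GRing.isLinear.Build R U 'rV[R]_d.+1 _ (point B)
  (point_is_linear B).

(** The equation of the facet in direction [i] through the origin ([false]) or
    opposite to it ([true]).  The sum omits [j = i] because the opposite
    facet contains the plane [X_i]. *)
Definition facet (M : slopes) (i : 'I_N) (e : bool) (v : U) : 'rV[R]_n :=
  if e then v None - \sum_(j | j != i) v (Some j) *m M i j else v (Some i).

Fact facet_is_linear M i e : linear (facet M i e).
Proof.
move=> c u v; case: e; rewrite /facet !ffunE //.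
under eq_bigr do rewrite !ffunE mulmxDl -scalemxAl.
rewrite big_split -scaler_sumr scalerBr opprD !addrA; congr (_ + _).
by rewrite -!addrA; congr (_ + _); rewrite addrC.
Qed.
HB.instance Definition _ M i e := GRing.isLinear.Build R U 'rV[R]_n _
  (facet M i e) (facet_is_linear M i e).

Lemma dim_coords : \dim {: U} = (N.+1 * n)%N.
Proof. by rewrite dimvf /dim /= card_option card_ord /dim /= mul1n. Qed.

Definition independent (B : base_frames) : Prop :=
  forall (Z : {set 'I_N}) (v : U), #|~: Z| = 3%N ->
    (forall l, l \in Z -> v (Some l) = 0) -> point B v = 0 -> v = 0.

(** The affine constraints satisfied by the coefficients of frames of initial
    data on the base frames; a segment preserves them. *)
Definition coordinates (C : coefs) : Prop :=
  (forall o o', C (base o) o' = if o == o' then 1%:M else 0) /\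
  (forall (s : init_vertex N) j, j \notin val s -> C s (Some j) = 0).

Definition realize (B : base_frames) (C : coefs) : frames :=
  fun s => \sum_o C s o *m B o.

Lemma realize_base B C o : coordinates C -> realize B C (base o) = B o.
Proof.
move=> [Cbase _]; rewrite /realize (bigD1 o) //= Cbase eqxx mul1mx big1 ?addr0 //.
by move=> o' o'o; rewrite Cbase eq_sym (negPf o'o) mul0mx.
Qed.

Definition coef_row (C : coefs) s (u : 'rV[R]_n) : U := [ffun o => u *m C s o].

Lemma point_coef_row B C s u : point B (coef_row C s u) = u *m realize B C s.
Proof.
by rewrite mulmx_sumr; apply: eq_bigr => o _; rewrite ffunE mulmxA.
Qed.

(** The equation of the facet opposite to the origin in direction [i] is forced
    by the planes [X_ij]: a vector of [X_ij] has blocks [u P], [u Q], [u T] at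
    [None], [Some i], [Some j], so that its block at [None] is its block at
    [Some j] times the inverse of [T] times [P]. *)
Definition slope (C : coefs) : slopes := fun i j =>
  invmx (C (v2 i j) (Some j)) *m C (v2 i j) None.

(** General position of the facets: any vertex together with one opposite
    facet cuts out zero, and the projection is injective on 3-faces. *)
Definition transversal (B : base_frames) (M : slopes) : Prop :=
  (forall (S : {set 'I_N}) j (v : U), (forall l, facet M l (l \in S) v = 0) ->
     facet M j (j \notin S) v = 0 -> v = 0) /\
  (forall (Z S : {set 'I_N}) (v : U), #|~: Z| = 3%N ->
     (forall l, l \in Z -> facet M l (l \in S) v = 0) -> point B v = 0 -> v = 0).

Lemma init_vertexP (s : init_vertex N) :
  (exists o, s = base o) \/ (exists i j, i != j /\ s = v2 i j).
Proof.
case: s => S leS; have [|lt2] := leqP #|S| 1.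
  rewrite leq_eqVlt ltnS leqn0 => /orP[/cards1P[i Si]|S0]; left.
    by exists (Some i); apply: val_inj.
  by exists None; apply: val_inj; apply/eqP; rewrite -cards_eq0.
have /cards2P[i [j [ij Sij]]] : #|S| == 2 by rewrite eqn_leq leS.
by right; exists i, j; split=> //; apply: val_inj.
Qed.

Lemma v2C (i j : 'I_N) : v2 i j = v2 j i.
Proof. by apply: val_inj; rewrite /= setUC. Qed.

(** Both facets in direction [i] were chosen to pass through the
    given planes; for [X_ij] this uses that its coordinates define [slope i j] and
    [slope j i] at the same time. *)
Lemma facet_coef_row C (s : init_vertex N) l u : coordinates C ->
  (forall i j, i != j -> C (v2 i j) (Some j) \in unitmx) ->
  facet (slope C) l (l \in val s) (coef_row C s u) = 0.
Proof.
move=> [Cbase Csupp] Cunit; rewrite /facet; case: ifPn => ls; last first.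
  by rewrite ffunE Csupp // mulmx0.
have [[o sE]|[i [j [ij sE]]]] := init_vertexP s.
  have oE : o = Some l.
    by case: o sE ls => [i|] ->; rewrite /= ?inE // => /eqP->.
  rewrite sE oE ffunE Cbase mulmx0 big1 ?subrr // => j jl.
  by rewrite ffunE Cbase (inj_eq Some_inj) eq_sym (negPf jl) mulmx0 mul0mx.
wlog li : i j ij sE / l = i => [wl|].
  have : l \in [set i; j] by move: ls; rewrite sE.
  rewrite in_set2 => /orP[/eqP li|/eqP lj]; first exact: (wl i j).
  by apply: (wl j i) => //; rewrite 1?eq_sym // sE v2C.
rewrite {ls}li (bigD1 j) ?[j == i]eq_sym //= big1 => [|k /andP[ki kj]].
  by rewrite addr0 !ffunE /slope sE mulmxA -[_ *m _ *m invmx _]mulmxA mulmxV ?Cunit //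
    mulmx1 subrr.
by rewrite ffunE Csupp ?mulmx0 ?mul0mx // sE !inE negb_or ki kj.
Qed.

Lemma transversal_solution (X : init_vertex N -> grass R d r) B C :
  (2 < N)%N -> frame X (realize B C) -> coordinates C ->
  (forall i j, i != j -> C (v2 i j) (Some j) \in unitmx) ->
  transversal B (slope C) ->
  exists! Y : {ffun {set 'I_N} -> grass R d r}, solution X Y.
Proof.
move=> N_gt2 frX CC Cunit [indep inj].
pose xi i e := linfun (facet (slope C) i e); pose pi := linfun (point B).
have cap0 (A A' : {vspace U}) : (forall v, v \in A -> v \in A' -> v = 0) ->
    (A :&: A' = 0)%VS.
  move=> h; apply/eqP; rewrite -subv0; apply/subvP => v.
  by rewrite memv_cap memv0 => /andP[/h vA' /vA' ->].
apply: (@exists_unique_solution _ _ _ _ _ xi pi N_gt2 dim_coords).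
- move=> S j; apply: cap0 => v /mem_flat hv; rewrite memv_ker lfunE /= => /eqP.
  by apply: indep => l; have := hv l; rewrite inE lfunE; apply.
- move=> Z S cardZ; apply: cap0 => v /mem_flat hv.
  rewrite memv_ker lfunE /= => /eqP; apply: (inj Z S) => // l /hv.
  by rewrite lfunE.
move=> s; apply/subvP => w /(mem_frame _ _ frX)[u ->].
rewrite -point_coef_row -(lfunE (point B)); apply: memv_img; apply/mem_flat => l _.
by rewrite lfunE /=; apply: facet_coef_row.
Qed.

(** For the vertex at the origin, the equations of the facets are the
    vanishing of the blocks. *)
Lemma transversal_independent B M : transversal B M -> independent B.
Proof.
move=> [_ inj] Z v Z3 vZ; apply: (inj Z set0) => // l lZ.
by rewrite /facet inE vZ.
Qed.

Lemma base_inj : injective base.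
Proof.
move=> [i|] [j|] // /(congr1 val)/= /setP; last 2 first.
- by move/(_ i); rewrite !inE eqxx.
- by move/(_ j); rewrite !inE eqxx.
by move/(_ i); rewrite !inE eqxx => /esym/eqP->.
Qed.

Lemma base_neq_v2 o i j : i != j -> base o != v2 i j.
Proof.
move=> ij; apply/eqP => /(congr1 (fun s : init_vertex N => #|val s|))/=.
rewrite cards2 ij.
by case: o => [l|] /=; rewrite ?cards1 ?cards0.
Qed.

Lemma eq_point B B' v : (forall o, B o = B' o) -> point B v = point B' v.
Proof. by move=> BB'; apply: eq_bigr => o _; rewrite BB'. Qed.

(** The dimension condition on the initial data says that the planes are in
    direct sum, since each of them has dimension [n]. *)
Lemma dim_base_span X A i j k : frame X A -> i != j -> i != k -> j != k ->
  \dim (X (v0 N) + X (v1 i) + X (v1 j) + X (v1 k))%VS = (4 * r + 3).+1%N <->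
  (forall v : U, (forall l, l \notin [set i; j; k] -> v (Some l) = 0) ->
     point (A \o base) v = 0 -> v = 0).
Proof.
move=> frX ij ik jk.
pose D := None |: (Some i |: (Some j |: [set Some k])).
have inD l : (Some l \in D) = (l \in [set i; j; k]).
  by rewrite !inE !(inj_eq Some_inj) -!orbA.
have bigD (T : Type) (idx : T) (op : Monoid.com_law idx) F :
    \big[op/idx]_(o in D) F o = op (op (op (F None) (F (Some i))) (F (Some j)))
      (F (Some k)).
  rewrite /D !big_setU1 ?big_set1 ?inE ?(inj_eq Some_inj) ?negb_or ?ij ?ik //.
  by rewrite !Monoid.mulmA.
have pointD (v : U) : (forall l, l \notin [set i; j; k] -> v (Some l) = 0) ->
    point (A \o base) v = \sum_(o in D) v o *m A (base o).
  move=> vD; rewrite [RHS]big_mkcond; apply: eq_bigr => -[m|] _ /=.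
    by rewrite inD; case: ifPn => // /vD ->; rewrite mul0mx.
  by rewrite !inE.
have dimE : (\dim (X (v0 N) + X (v1 i) + X (v1 j) + X (v1 k))%VS == (4 * r + 3).+1%N)
    = directv (\sum_(o in D) plane (X (base o)))%VS.
  by rewrite directvE /= !bigD /= !grass_dim; congr (_ == _); lia.
split=> [/eqP|h]; last apply/eqP; rewrite dimE.
  move=> /directv_sum_independent h v vD; rewrite pointD // => vA.
  apply/ffunP => o; rewrite ffunE; have [oD|] := boolP (o \in D); last first.
    case: o => [l|]; last by rewrite !inE.
    by rewrite inD; apply: vD.
  apply: (frame_inj frX (s := base o)).
  apply: (h (fun o => v o *m A (base o))) => // o' _.
  by apply/(mem_frame _ _ frX); exists (v o').
apply/directv_sum_independent => us usX us0.
have [w wE] : exists w : option 'I_N -> 'rV[R]_n,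
    forall o, o \in D -> us o = w o *m A (base o).
  apply: (@fin_all_exists _ (fun=> 'rV[R]_n)
    (fun o x => o \in D -> us o = x *m A (base o))) => o.
  have [oD|] := boolP (o \in D); last by exists 0.
  by have /(mem_frame _ _ frX)[x xE] := usX _ oD; exists x.
pose v : U := [ffun o => if o \in D then w o else 0].
have v_supp l : l \notin [set i; j; k] -> v (Some l) = 0.
  by rewrite ffunE inD => /negPf->.
have v_eq0 : v = 0.
  apply: h => //; rewrite pointD // -[RHS]us0; apply: eq_bigr => o oD.
  by rewrite ffunE oD wE.
move=> o oD; have : v o = 0 by rewrite v_eq0 ffunE.
by rewrite ffunE oD wE // => ->; rewrite mul0mx.
Qed.

Lemma card3P (Z : {set 'I_N}) : #|~: Z| = 3%N ->
  exists i j k, [/\ i != j, i != k, j != k & ~: Z = [set i; j; k]].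
Proof.
move=> Z3; have : (2 < #|~: Z|)%N by rewrite Z3.
move=> /card_gt2P[i [j [k [[iZ jZ kZ] [ij jk ki]]]]]; exists i, j, k.
have ik : i != k by rewrite eq_sym.
split=> //; apply/esym/eqP; rewrite eqEcard; apply/andP; split.
  by apply/subsetP => l; rewrite !in_setU !in_set1 => /orP[/orP[]|] /eqP->.
by rewrite Z3 -setUA cardsU1 cards2 !inE negb_or ij ik jk.
Qed.

Lemma initial_data_coordinates X A : initial_data X -> frame X A ->
  independent (A \o base) /\
  exists C, coordinates C /\ forall s, A s = realize (A \o base) C s.
Proof.
move=> [dimX subX] frX; split.
  move=> Z v /card3P[i [j [k [ij ik jk ZE]]]] vZ.
  apply: (proj1 (dim_base_span frX ij ik jk)) => [|l lZ]; first exact: dimX.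
  by apply: vZ; rewrite -ZE inE negbK in lZ.
have sub_v2 i j : i != j ->
    (X (v2 i j) <= X (v0 N) + X (v1 i) + X (v1 j))%VS.
  rewrite neq_ltn => /orP[/subX //|/subX].
  by rewrite v2C -addvA (addvC (X (v1 j))) addvA.
have [C CP] : exists C : coefs, forall s,
    [/\ A s = \sum_o C s o *m A (base o),
        forall j, j \notin val s -> C s (Some j) = 0
      & forall o, s = base o -> forall o', C s o' = if o == o' then 1%:M else 0].
  apply: (@fin_all_exists _ (fun=> option 'I_N -> 'M[R]_n) (fun s c =>
    [/\ A s = \sum_o c o *m A (base o),
        forall j, j \notin val s -> c (Some j) = 0
      & forall o, s = base o -> forall o', c o' = if o == o' then 1%:M else 0])).
  move=> s; have [[o ->]|[i [j [ij ->]]]] := init_vertexP s.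
    exists (fun o' => if o == o' then 1%:M else 0); split.
    - rewrite (bigD1 o) //= eqxx mul1mx big1 ?addr0 // => o' /negPf o'o.
      by rewrite eq_sym o'o mul0mx.
    - by move=> j; case: o => //= i; rewrite inE eq_sym (inj_eq Some_inj) => /negPf->.
    - by move=> o1 /base_inj->.
  have [c cE] : exists c : 'I_n -> 'rV[R]_n * 'rV[R]_n * 'rV[R]_n, forall a,
      row a (A (v2 i j)) = (c a).1.1 *m A (v0 N) + (c a).1.2 *m A (v1 i)
        + (c a).2 *m A (v1 j).
    apply: (@fin_all_exists _ (fun=> ('rV[R]_n * 'rV[R]_n * 'rV[R]_n)%type)
      (fun a c => row a (A (v2 i j)) = c.1.1 *m A (v0 N) + c.1.2 *m A (v1 i)
        + c.2 *m A (v1 j))) => a.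
    have /(subvP (sub_v2 _ _ ij)) : row a (A (v2 i j)) \in plane (X (v2 i j)).
      by apply/(mem_frame _ _ frX); exists (delta_mx 0 a); rewrite -rowE.
    move=> /memv_addP[w /memv_addP[x /(mem_frame _ _ frX)[x' ->]]].
    move=> [y /(mem_frame _ _ frX)[y' ->] ->] [z /(mem_frame _ _ frX)[z' ->] ->].
    by exists (x', y', z').
  pose mx (p : 'I_n -> 'rV[R]_n) : 'M[R]_n := \matrix_a p a.
  exists (fun o => if o is Some l then
      if l == i then mx (fun a => (c a).1.2)
      else if l == j then mx (fun a => (c a).2) else 0
    else mx (fun a => (c a).1.1)).
  split=> [|l|o /esym/eqP]; last by rewrite (negPf (base_neq_v2 o ij)).
    rewrite (bigD1 None) // (bigD1 (Some i)) // (bigD1 (Some j)) /=; last first.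
      by rewrite (inj_eq Some_inj) eq_sym.
    rewrite !eqxx [j == i]eq_sym (negPf ij) big1 => [|[l|] //]; last first.
      rewrite !(inj_eq Some_inj) => /andP[/andP[_ /negPf->] /negPf->].
      by rewrite mul0mx.
    rewrite addr0; apply/row_matrixP => a.
    by rewrite cE !linearD /= !row_mul !rowK addrA.
  by rewrite /= !inE negb_or => /andP[/negPf-> /negPf->].
exists C; split; last by move=> s; have [] := CP s.
split=> [o o'|s j js]; first by have [_ _ /(_ o)->] := CP (base o).
by have [_ ->] := CP s.
Qed.

Lemma coordinates_initial_data X B C : frame X (realize B C) ->
  coordinates C -> independent B -> initial_data X.
Proof.
move=> frX CC indB; split=> [i j k ij ik jk|i j ij].
  apply/(dim_base_span frX ij ik jk) => v vZ; rewrite (@eq_point _ B) => [|o].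
    apply: (indB (~: [set i; j; k])) => [|l]; last by rewrite inE => /vZ.
    by rewrite setCK -setUA cardsU1 cards2 !inE negb_or ij ik jk.
  exact: realize_base.
apply/subvP => w /(mem_frame _ _ frX)[u ->].
have memB o x : x *m B o \in plane (X (base o)).
  by apply/(mem_frame _ _ frX); exists x; rewrite realize_base.
rewrite mulmx_sumr; apply: memv_suml => -[l|] _; rewrite mulmxA; last first.
  by rewrite -addvA; apply: (subvP (addvSl _ _)); apply: memB None _.
have [->|li] := eqVneq l i.
  rewrite -addvA (addvC (X (v1 i))) addvA.
  by apply: (subvP (addvSr _ _)); apply: memB (Some i) _.
have [->|lj] := eqVneq l j.
  by apply: (subvP (addvSr _ _)); apply: memB (Some j) _.
by case: CC => _ ->; rewrite ?mulmx0 ?mul0mx ?mem0v // !inE negb_or li lj.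
Qed.

End Coordinates.

(** * Openness and irreducibility *)

Lemma exists_superset (T : finType) (S : {set T}) k :
  (#|S| <= k <= #|T|)%N -> exists2 S' : {set T}, S \subset S' & #|S'| = k.
Proof.
move=> /andP[leSk lekT].
exists (S :|: [set x in take (k - #|S|) (enum (~: S))]); first exact: subsetUl.
rewrite cardsU (_ : _ :&: _ = set0) ?cards0 ?subn0.
  rewrite cardsE (card_uniqP _) ?take_uniq ?enum_uniq // size_take -cardE.
  rewrite -(cardsC S) in lekT; move: #|S| #|~: S| leSk lekT => a b.
  by case: ltnP; lia.
apply/setP => x; rewrite !inE; apply/andP => -[xS /mem_take].
by rewrite mem_enum inE xS.
Qed.

Section EntryAlgebra.
Variables (R : realType) (d r : nat) (I : finType).
Local Notation frames := (I -> 'M[R]_(r.+1, d.+1)).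

Definition entry_poly (f : frames -> R) : Prop :=
  exists p : {mpoly R[#|entry_idx d r I|]}, forall A, f A = p.@[entries A].

Fact entry_poly_const c : entry_poly (fun=> c).
Proof. by exists c%:MP => A; rewrite mevalC. Qed.

Fact entry_poly_add f g :
  entry_poly f -> entry_poly g -> entry_poly (fun A => f A + g A).
Proof. by move=> [p pE] [q qE]; exists (p + q) => A; rewrite mevalD pE qE. Qed.

Fact entry_poly_mul f g :
  entry_poly f -> entry_poly g -> entry_poly (fun A => f A * g A).
Proof. by move=> [p pE] [q qE]; exists (p * q) => A; rewrite mevalM pE qE. Qed.

Definition entry_algebra : function_algebra R frames :=
  FunctionAlgebra entry_poly_const entry_poly_add entry_poly_mul.

Lemma entry_poly_entry s a c : entry_algebra (fun A => A s a c).
Proof.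
exists 'X_(enum_rank (s, a, c)) => A.
by rewrite mevalXU /entries enum_rankK.
Qed.

End EntryAlgebra.

Section PolynomialCurves.
Variable R : realType.

Definition curve_poly (f : R -> R) : Prop :=
  exists p : {poly R}, forall t, f t = p.[t].

Fact curve_poly_const c : curve_poly (fun=> c).
Proof. by exists c%:P => t; rewrite hornerC. Qed.

Fact curve_poly_add f g :
  curve_poly f -> curve_poly g -> curve_poly (fun t => f t + g t).
Proof. by move=> [p pE] [q qE]; exists (p + q) => t; rewrite hornerD pE qE. Qed.

Fact curve_poly_mul f g :
  curve_poly f -> curve_poly g -> curve_poly (fun t => f t * g t).
Proof. by move=> [p pE] [q qE]; exists (p * q) => t; rewrite hornerM pE qE. Qed.

Definition curve_algebra : function_algebra R R :=
  FunctionAlgebra curve_poly_const curve_poly_add curve_poly_mul.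

Lemma curve_poly_ext (f g : R -> R) :
  (forall t, f t = g t) -> curve_algebra f -> curve_algebra g.
Proof. by move=> fg [p pE]; exists p => t; rewrite -fg. Qed.

Lemma curve_poly_sum (I : Type) (s : seq I) (P : pred I) (f : I -> R -> R) :
  (forall i, curve_algebra (f i)) ->
  curve_algebra (fun t => \sum_(i <- s | P i) f i t).
Proof.
move=> fP; elim: s => [|i s IH].
  by apply: curve_poly_ext (curve_poly_const 0) => t; rewrite big_nil.
case Pi: (P i); last by apply: curve_poly_ext IH => t; rewrite big_cons Pi.
apply: curve_poly_ext (curve_poly_add (fP i) IH) => t.
  by rewrite big_cons Pi.
Qed.

Lemma curve_poly_prod (I : Type) (s : seq I) (f : I -> R -> R) :
  (forall i, curve_algebra (f i)) ->
  curve_algebra (fun t => \prod_(i <- s) f i t).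
Proof.
move=> fP; elim: s => [|i s IH].
  by apply: curve_poly_ext (curve_poly_const 1) => t; rewrite big_nil.
by apply: curve_poly_ext (curve_poly_mul (fP i) IH) => t; rewrite big_cons.
Qed.

Lemma curve_poly_exp f k : curve_algebra f -> curve_algebra (fun t => f t ^+ k).
Proof.
move=> fP; apply: (curve_poly_ext (f := fun t => \prod_(i < k) f t)) => [t|].
  by rewrite prodr_const card_ord.
exact: curve_poly_prod.
Qed.

Lemma curve_poly_entry_poly (d r : nat) (I : finType) f
    (A : R -> I -> 'M[R]_(r.+1, d.+1)) :
  (forall s a c, curve_algebra (fun t => A t s a c)) ->
  entry_algebra R d r I f -> curve_algebra (fun t => f (A t)).
Proof.
move=> AP [p pE]; apply: (curve_poly_ext (f := fun t => \sum_(m <- msupp p)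
    p@_m * \prod_i entries (A t) i ^+ m i)) => [t|].
  by rewrite pE mevalE.
apply: curve_poly_sum => m; apply: curve_poly_mul; first exact: curve_poly_const.
by apply: curve_poly_prod => i; apply: curve_poly_exp; apply: AP.
Qed.

(** The line is irreducible: a product of two nonzero polynomials has finitely
    many roots. *)
Lemma near_meet t0 t1 (P Q : R -> Prop) :
  near curve_algebra t0 P -> near curve_algebra t1 Q -> exists t, P t /\ Q t.
Proof.
move=> [f [[p pE] f0 fP]] [g [[q qE] g1 gQ]].
have pq0 : p * q != 0.
  apply: mulf_neq0; apply/eqP => e0; [move: f0|move: g1];
    by rewrite ?pE ?qE e0 horner0 eqxx.
pose s : seq R := [seq i%:R | i <- iota 0 (size (p * q))].
have uniq_s : uniq s.
  by rewrite map_inj_uniq ?iota_uniq // => i j /eqP; rewrite eqr_nat => /eqP.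
have : ~~ all (root (p * q)) s.
  apply/negP => /(max_poly_roots pq0)/(_ uniq_s).
  by rewrite size_map size_iota ltnn.
move=> /allPn[t _]; rewrite rootM negb_or => /andP[pt qt]; exists t.
by split; [apply: fP; rewrite pE|apply: gQ; rewrite qE].
Qed.

End PolynomialCurves.

Section LinearFunctionals.
Variables (R : realType) (r N : nat).
Local Notation U := {ffun option 'I_N -> 'rV[R]_r.+1}.

Lemma linear_entry (V : lmodType R) m (f : {linear V -> 'rV[R]_m}) c :
  scalar (fun v => f v 0 c).
Proof. by move=> a u v; rewrite linearP !mxE. Qed.

Lemma scalar0 (V : lmodType R) : scalar (fun _ : V => 0 : R).
Proof. by move=> a u v; rewrite mulr0 addr0. Qed.

Lemma scalar_coord (o : option 'I_N) b : scalar (fun v : U => v o 0 b).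
Proof. by move=> a u v; rewrite !ffunE !mxE. Qed.

End LinearFunctionals.

Section OpenTransversality.
Variables (R : realType) (d r N : nat) (T : Type) (alg : function_algebra R T).
Variable t0 : T.
Local Notation n := r.+1.

Lemma regular_point (B : T -> option 'I_N -> 'M[R]_(n, d.+1)) v c :
  (forall o, regular_mx alg t0 (fun t => B t o)) ->
  regular alg t0 (fun t => point (B t) v 0 c).
Proof.
move=> rB; apply: (regular_ext (f := fun t => \sum_o (v o *m B t o) 0 c)) => [t|].
  by rewrite summxE.
apply: regular_sum => o _; apply: regular_mulmx => //.
exact: regular_mx_const.
Qed.

(** Transversality is a finite conjunction of injectivity conditions on linear
    systems with rational coefficients. *)
Lemma near_transversal (B : T -> option 'I_N -> 'M[R]_(n, d.+1))
    (M : T -> 'I_N -> 'I_N -> 'M[R]_n) :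
  (forall o, regular_mx alg t0 (fun t => B t o)) ->
  (forall i j, i != j -> regular_mx alg t0 (fun t => M t i j)) ->
  transversal (B t0) (M t0) -> near alg t0 (fun t => transversal (B t) (M t)).
Proof.
move=> rB rM [indep inj].
have rfacet l e v b : regular alg t0 (fun t => facet (M t) l e v 0 b).
  case: e; last exact: regular_const.
  apply: (regular_ext (f := fun t => v None 0 b -
      \sum_(j | j != l) (v (Some j) *m M t l j) 0 b)) => [t|].
    by rewrite /facet !mxE summxE.
  apply: regular_add; first exact: regular_const.
  apply: regular_opp; apply: regular_sum => j jl.
  apply: regular_mulmx; first exact: regular_mx_const.
  by apply: rM; rewrite eq_sym.
apply: near_and.
  apply: near_forall => S; apply: near_forall => j.
  pose Phi t (k : 'I_N * 'I_n + 'I_n) v := match k with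
    | inl (l, b) => facet (M t) l (l \in S) v 0 b
    | inr b => facet (M t) j (j \notin S) v 0 b
    end.
  have lin t k : scalar (Phi t k) by case: k => [[l b]|b]; apply: linear_entry.
  have reg k v : regular alg t0 (fun t => Phi t k v).
    by case: k => [[l b]|b]; apply: rfacet.
  apply: near_mono (near_injective lin reg _) => [t injA v vS vj|v v0].
    by apply: injA => -[[l b]|b]; rewrite /= ?vS ?vj mxE.
  apply: (indep S j) => [l|]; apply/rowP => b; rewrite mxE.
    exact: (v0 (inl (l, b))).
  exact: (v0 (inr b)).
apply: near_forall => Z; apply: near_forall => S.
pose Phi t (k : 'I_N * 'I_n + 'I_d.+1) v := match k with
  | inl (l, b) => if l \in Z then facet (M t) l (l \in S) v 0 b else 0
  | inr c => point (B t) v 0 c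
  end.
have lin t k : scalar (Phi t k).
  case: k => [[l b]|c]; last exact: linear_entry.
  by rewrite /Phi; case: (l \in Z); [apply: linear_entry|apply: scalar0].
have reg k v : regular alg t0 (fun t => Phi t k v).
  case: k => [[l b]|c]; last exact: regular_point.
  by rewrite /Phi; case: (l \in Z); [apply: rfacet|apply: regular_const].
have [Z3|/eqP Z3] := eqVneq #|~: Z| 3%N; last by apply: near_true => t v /Z3.
apply: near_mono (near_injective lin reg _) => [t injA v _ vZ vp|v v0].
  apply: injA => -[[l b]|b]; rewrite /= ?vp ?mxE //.
  by case: ifP => // /vZ ->; rewrite mxE.
apply: (inj Z S) => // [l lZ|]; apply/rowP => b; rewrite mxE.
  by have := v0 (inl (l, b)); rewrite /= lZ.
exact: (v0 (inr b)).
Qed.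

End OpenTransversality.

Section Openness.
Variables (R : realType) (d r N : nat).
Local Notation n := r.+1.
Local Notation U := {ffun option 'I_N -> 'rV[R]_n}.
Local Notation frames := (init_vertex N -> 'M[R]_(n, d.+1)).
Local Notation alg := (entry_algebra R d r (init_vertex N)).

Lemma regular_base (A0 : frames) o :
  regular_mx alg A0 (fun A => (A \o @base N) o).
Proof. by move=> a c; apply/regular_poly/entry_poly_entry. Qed.

(** The coordinates of a frame on the base frames solve a linear system, made
    injective by adjoining the equations for the blocks that have to vanish.  Its
    coefficients are entries of the frames, whence the rationality. *)
Lemma regular_coordinates (A0 : frames) : (3 <= N)%N ->
  independent (A0 \o @base N) ->
  exists C : frames -> init_vertex N -> option 'I_N -> 'M[R]_n,
    (forall s o, regular_mx alg A0 (fun A => C A s o)) /\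
    near alg A0 (fun A => forall C', coordinates C' ->
      A = realize (A \o @base N) C' -> C' = C A).
Proof.
move=> N_gt2 indep.
pose Phi (s : init_vertex N) (A : frames) (k : 'I_d.+1 + 'I_N * 'I_n) (v : U) :=
  match k with
  | inl c => point (A \o @base N) v 0 c
  | inr (l, b) => if l \in val s then 0 else v (Some l) 0 b
  end.
have sol (sa : init_vertex N * 'I_n) : exists u : frames -> U,
    (forall l : U -> R, scalar l -> regular alg A0 (fun A => l (u A))) /\
    near alg A0 (fun A => forall v, (forall k, Phi sa.1 A k v =
      if k is inl c then A sa.1 sa.2 c else 0) -> v = u A).
  case: sa => s a /=; apply: regular_solution.
  - move=> A [c|[l b]] /=; first exact: linear_entry.
    by rewrite /Phi; case: (l \in val s); [apply: scalar0|apply: scalar_coord].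
  - move=> [c|[l b]] v /=; first exact/regular_point/regular_base.
    exact: regular_const.
  - move=> [c|_]; last exact: regular_const.
    exact/regular_poly/entry_poly_entry.
  move=> v v0.
  (* Independence speaks of three directions; [s] has at most two. *)
  have [S' sS' S'3] : exists2 S' : {set 'I_N}, val s \subset S' & #|S'| = 3%N.
    apply: exists_superset; rewrite card_ord N_gt2 andbT; apply: leqW (valP s).
  apply: (indep (~: S')) => [|l|]; rewrite ?setCK //.
    rewrite inE => lS'; apply/rowP => b; have := v0 (inr (l, b)).
    by rewrite /= ifN ?mxE //; apply: contra lS'; apply: subsetP.
  by apply/rowP => c; rewrite mxE; apply: (v0 (inl c)).
have [u uP] := fin_all_exists sol.
exists (fun A s o => \matrix_(a, b) u (s, a) A o 0 b); split.
  move=> s o a b; apply: (regular_ext (f := fun A => u (s, a) A o 0 b)) => [A|].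
    by rewrite mxE.
  by have [reg _] := uP (s, a); apply: (reg _ (scalar_coord o b)).
have near_u := near_forall (fun sa => proj2 (uP sa)).
apply: near_mono near_u => A uA C' CC' AE; apply: funext => s; apply: funext => o.
apply/matrixP => a b; rewrite mxE -(uA (s, a) (coef_row C' s (delta_mx 0 a))).
  by rewrite ffunE -rowE mxE.
move=> [c|[l b']] /=.
  by rewrite point_coef_row -AE -rowE mxE.
by case: ifPn => // ls; rewrite ffunE (proj2 CC') // mulmx0 mxE.
Qed.

Lemma regular_slope (A0 : frames)
    (C : frames -> init_vertex N -> option 'I_N -> 'M[R]_n) i j :
  (forall s o, regular_mx alg A0 (fun A => C A s o)) ->
  C A0 (v2 i j) (Some j) \in unitmx ->
  regular_mx alg A0 (fun A => slope (C A) i j).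
Proof. by move=> rC uC; apply: regular_mulmx => //; apply: regular_invmx. Qed.

(** Near a transversal point, the coordinates of a frame and then the slopes
    are rational functions, so that transversality and the invertibility of the
    blocks defining the slopes persist. *)
Theorem near_solution (A0 : frames) C0 : (3 <= N)%N ->
  coordinates C0 ->
  A0 = realize (A0 \o @base N) C0 ->
  (forall i j, i != j -> C0 (v2 i j) (Some j) \in unitmx) ->
  transversal (A0 \o @base N) (slope C0) ->
  near alg A0 (fun A => forall X, initial_data X -> frame X A ->
    exists! Y : {ffun {set 'I_N} -> grass R d r}, solution X Y).
Proof.
move=> N_gt2 CC0 AE0 unit0 trans0.
have [C [rC nearC]] := regular_coordinates N_gt2 (transversal_independent trans0).
have CE0 : C0 = C A0 by apply: (near_at nearC).
rewrite CE0 in unit0 trans0.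
have near_unit : near alg A0 (fun A => forall i j, i != j ->
    C A (v2 i j) (Some j) \in unitmx).
  apply: near_forall => i; apply: near_forall => j; apply: near_imply => ij.
  by apply: near_unitmx; [apply: rC|apply: unit0].
have near_trans : near alg A0 (fun A =>
    transversal (A \o @base N) (slope (C A))).
  apply: (near_transversal (B := fun A => A \o @base N)
    (M := fun A => slope (C A))) => // [|i j ij]; first exact: regular_base.
  by apply: regular_slope => //; apply: unit0.
apply: near_and_mono near_trans (near_and nearC near_unit) _.
move=> A transA [CA unitA] X initX frX.
have [_ [C' [CC' AE]]] := initial_data_coordinates initX frX.
have {}AE : A = realize (A \o @base N) C' by apply: funext.
have C'E := CA C' CC' AE; rewrite -C'E in transA unitA.
by apply: (transversal_solution (B := A \o @base N) N_gt2 _ CC') => //; rewrite -AE.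
Qed.

End Openness.

(** * A nondegenerate model *)

Section Model.
Variables (R : realType) (r N d : nat).
Local Notation n := r.+1.
Local Notation U := {ffun option 'I_N -> 'rV[R]_n}.

(** The parameters [node i e] and [sample b] are pairwise distinct integers. *)
Definition node (i : 'I_N) (e : bool) : R := (i.*2 + e)%:R.
Definition sample (b : nat) : R := (N.*2 + b)%:R.

(** The vertex [S] of the model net, for which evaluation at [node i e] is the
    equation of a facet. *)
Definition cube_poly (S : {set 'I_N}) : {poly R} :=
  \prod_i ('X - (node i (i \in S))%:P).

Lemma eq_node i e j f : (node i e == node j f) = (i == j) && (e == f).
Proof.
rewrite /node eqr_nat; apply/eqP/andP => [h|[/eqP-> /eqP->] //].
have ij : i = j :> nat by case: e f h => -[] /=; lia.
by rewrite -val_eqE /= ij eqxx; case: e f h => -[] //=; lia.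
Qed.

Lemma eq_sample_node b i e : (sample b == node i e) = false.
Proof.
apply/negP; rewrite /sample /node eqr_nat => /eqP.
by have := ltn_ord i; case: e => /=; lia.
Qed.

Lemma eq_sample b c : (sample b == sample c) = (b == c).
Proof. by rewrite /sample eqr_nat eqn_add2l. Qed.

Lemma root_cube_poly S x :
  root (cube_poly S) x = [exists i, x == node i (i \in S)].
Proof.
rewrite /root horner_prod; apply/eqP/existsP => [/eqP|[i /eqP xi]].
  by move=> /prodf_eq0[i _]; rewrite !hornerE subr_eq0 => xi; exists i.
by apply/eqP/prodf_eq0; exists i => //; rewrite !hornerE xi subrr.
Qed.

Lemma root_cube_poly_node S i e : root (cube_poly S) (node i e) = (e == (i \in S)).
Proof.
rewrite root_cube_poly; apply/existsP/eqP => [[j]|->]; last by exists i.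
by rewrite eq_node => /andP[/eqP<- /eqP].
Qed.

Lemma root_cube_poly_sample S b : root (cube_poly S) (sample b) = false.
Proof. by rewrite root_cube_poly; apply/existsP => -[i]; rewrite eq_sample_node. Qed.

Lemma size_cube_poly S : size (cube_poly S) = N.+1.
Proof. by rewrite size_prod_XsubC /index_enum -enumT size_enum_ord. Qed.

Lemma cube_poly_split (S : {set 'I_N}) i j : i != j -> S \subset [set i; j] ->
  cube_poly S = ('X - (node i (i \in S))%:P) * ('X - (node j (j \in S))%:P) *
    \prod_(k | (k != i) && (k != j)) ('X - (node k false)%:P).
Proof.
move=> ij Sij; rewrite /cube_poly (bigD1 i) //= (bigD1 j) 1?eq_sym //= mulrA.
congr (_ * _); apply: eq_bigr => k /andP[ki kj]; congr ('X - (node k _)%:P).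
apply: negbTE; apply: contraNN ki => /(subsetP Sij).
by rewrite !inE (negPf kj) orbF.
Qed.

(** After division by the common factor these are four polynomials of degree 2.
    The coefficients come from evaluating at the roots [node i false] and
    [node j false], and from comparing leading coefficients. *)
Lemma cube_poly_square i j : i != j -> exists p q s,
  cube_poly [set i; j] =
    p *: cube_poly set0 + q *: cube_poly [set i] + s *: cube_poly [set j].
Proof.
move=> ij; have ji : j != i by rewrite eq_sym.
rewrite !(cube_poly_split ij) ?sub0set ?subxx ?sub1set ?inE ?eqxx ?orbT //.
rewrite ?(negPf ij) ?(negPf ji) /=.
set a := node i false; set a' := node i true.
set b := node j false; set b' := node j true.
set g := \prod_(k | _) _.
have ab : a - b != 0 by rewrite subr_eq0 eq_node (negPf ij).
(* Forget that the nodes are numerals, which [field] would expand. *)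
move: a a' b b' g ab => a a' b b' g ab.
pose p := (b' - a') / (a - b); pose q := (a - b') / (a - b).
pose s := (a' - b) / (a - b); exists p, q, s.
have e1 : 1 = p + q + s by rewrite /p /q /s; field.
have e2 : a' + b' = p * (a + b) + q * (a' + b) + s * (a + b').
  by rewrite /p /q /s; field.
have e3 : a' * b' = p * (a * b) + q * (a' * b) + s * (a * b').
  by rewrite /p /q /s; field.
rewrite -!mul_polyC !mulrA -!mulrDl; congr (_ * g).
have -> : ('X - a'%:P) * ('X - b'%:P) =
    1%:P * 'X ^+ 2 - (a' + b')%:P * 'X + (a' * b')%:P.
  by rewrite !rmorphD !rmorphM /=; ring.
rewrite e1 e2 e3 !rmorphD !rmorphM !rmorphD /=; ring.
Qed.

Lemma cube_poly_coordinates : exists c : init_vertex N -> option 'I_N -> R,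
  [/\ forall s : init_vertex N, cube_poly (val s) =
        \sum_o c s o *: cube_poly (val (base o)),
      forall o o', c (base o) o' = (o == o')%:R
    & forall (s : init_vertex N) j, j \notin val s -> c s (Some j) = 0].
Proof.
have [c cP] : exists c : init_vertex N -> option 'I_N -> R, forall s,
    [/\ cube_poly (val s) = \sum_o c s o *: cube_poly (val (base o)),
        forall o, s = base o -> forall o', c s o' = (o == o')%:R
      & forall j, j \notin val s -> c s (Some j) = 0].
  apply: (@fin_all_exists _ (fun=> option 'I_N -> R) (fun s c =>
    [/\ cube_poly (val s) = \sum_o c o *: cube_poly (val (base o)),
        forall o, s = base o -> forall o', c o' = (o == o')%:R
      & forall j, j \notin val s -> c (Some j) = 0])) => s.
  have [[o ->]|[i [j [ij ->]]]] := init_vertexP s.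
    exists (fun o' => (o == o')%:R); split.
    - rewrite (bigD1 o) //= eqxx scale1r big1 ?addr0 // => o' /negPf o'o.
      by rewrite eq_sym o'o scale0r.
    - by move=> o1 /base_inj->.
    - by move=> j; case: o => //= i; rewrite inE eq_sym (inj_eq Some_inj) => /negPf->.
  have [p [q [t pqt]]] := cube_poly_square ij.
  exists (fun o => if o is Some l then
    if l == i then q else if l == j then t else 0 else p).
  split=> [|o /esym/eqP|l]; last 2 first.
  - by rewrite (negPf (base_neq_v2 o ij)).
  - by rewrite /= !inE negb_or => /andP[/negPf-> /negPf->].
  rewrite (bigD1 None) // (bigD1 (Some i)) // (bigD1 (Some j)) /=; last first.
    by rewrite (inj_eq Some_inj) eq_sym.
  rewrite !eqxx [j == i]eq_sym (negPf ij) big1 => [|[l|] //]; last first.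
    rewrite !(inj_eq Some_inj) => /andP[/andP[_ /negPf->] /negPf->].
    by rewrite scale0r.
  by rewrite addr0 pqt addrA.
exists c; split=> [s|o o'|s j js]; first by have [] := cP s.
  by have [_ /(_ o)->] := cP (base o).
by have [_ _ ->] := cP s.
Qed.

(** The values of the polynomial of a vertex at the sample points, repeated
    diagonally [n] times.  The bound on [d] makes room for four samples. *)
Definition model_frame (s : init_vertex N) : 'M[R]_(n, d.+1) :=
  \matrix_(a, c) ((cube_poly (val s)).[sample (c %/ n)%N] *+ (c %% n == a)%N).

(** The component [a] of a block vector, read as a combination of the polynomials
    of the base vertices. *)
Definition coord_poly (v : U) (a : 'I_n) : {poly R} :=
  \sum_o v o 0 a *: cube_poly (val (base o)).

Lemma size_coord_poly v a : (size (coord_poly v a) <= N.+1)%N.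
Proof.
apply: leq_trans (size_sum _ _ _) _; apply/bigmax_leqP => o _.
by apply: leq_trans (size_scale_leq _ _) _; rewrite size_cube_poly.
Qed.

Lemma coord_poly_eq0 v a (s : seq R) :
  (N < size s)%N -> uniq s -> all (root (coord_poly v a)) s -> coord_poly v a = 0.
Proof.
move=> lt_s uniq_s roots; apply/eqP; apply: contraTT lt_s => p0.
rewrite -leqNgt -ltnS.
exact: leq_trans (max_poly_roots p0 roots uniq_s) (size_coord_poly v a).
Qed.

Lemma horner_coord_poly_false v a i : (coord_poly v a).[node i false] =
  v (Some i) 0 a * (cube_poly [set i]).[node i false].
Proof.
rewrite horner_sum (bigD1 (Some i)) //= hornerZ big1 ?addr0 // => o oi.
rewrite hornerZ (eqP (_ : root _ _)) ?mulr0 // root_cube_poly_node.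
by case: o oi => [j|] /=; rewrite inE // eq_sym (inj_eq Some_inj) => /negPf->.
Qed.

Lemma horner_coord_poly_true v a i : (coord_poly v a).[node i true] =
  v None 0 a * (cube_poly set0).[node i true] +
  \sum_(j | j != i) v (Some j) 0 a * (cube_poly [set j]).[node i true].
Proof.
rewrite horner_sum (bigD1 None) //= hornerZ; congr (_ + _).
rewrite (bigD1 (Some i)) //= hornerZ (eqP (_ : root _ _)); last first.
  by rewrite root_cube_poly_node inE eqxx.
rewrite mulr0 add0r (reindex_omap Some id) /=; last by case.
apply: eq_big => [j|j _]; last by rewrite hornerZ.
by rewrite eqxx andbT (inj_eq Some_inj).
Qed.

Lemma coord_poly_inj v : (0 < N)%N -> (forall a, coord_poly v a = 0) -> v = 0.
Proof.
move=> N_gt0 v0; apply/ffunP => o; apply/rowP => a; rewrite ffunE mxE.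
have vS i : v (Some i) 0 a = 0.
  have := horner_coord_poly_false v a i; rewrite v0 horner0 => /esym/eqP.
  rewrite mulf_eq0 => /orP[/eqP //|].
  by rewrite -[_ == 0]/(root _ _) root_cube_poly_node inE eqxx.
case: o => [i|]; first exact: vS.
have i : 'I_N := Ordinal N_gt0.
have := horner_coord_poly_true v a i; rewrite v0 horner0 big1 => [|j _]; last first.
  by rewrite vS mul0r.
rewrite addr0 => /esym/eqP; rewrite mulf_eq0 => /orP[/eqP //|].
by rewrite -[_ == 0]/(root _ _) root_cube_poly_node inE.
Qed.

Lemma sample_column (b : nat) (a : 'I_n) : (4 * r + 3 <= d)%N -> (b < 4)%N ->
  exists c : 'I_d.+1, (c %/ n = b /\ c %% n = a)%N.
Proof.
move=> le_rd b4; have lt_c : (b * n + a < d.+1)%N by have := ltn_ord a; nia.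
exists (Ordinal lt_c); split; rewrite /= addnC.
  by rewrite divnDMl // divn_small.
by rewrite addnC modnMDl modn_small.
Qed.

Lemma point_model_frame (v : U) (a : 'I_n) (c : 'I_d.+1) : (c %% n)%N = a ->
  point (model_frame \o @base N) v 0 c = (coord_poly v a).[sample (c %/ n)%N].
Proof.
move=> ca; rewrite /point summxE horner_sum; apply: eq_bigr => o _.
rewrite hornerZ mxE (bigD1 a) //= mxE ca eqxx mulr1n big1 ?addr0 // => a' a'a.
by rewrite mxE ca val_eqE eq_sym (negPf a'a) mulr0n mulr0.
Qed.

Lemma model_frame_free s (u : 'rV[R]_n) : (4 * r + 3 <= d)%N ->
  u *m model_frame s = 0 -> u = 0.
Proof.
move=> le_rd us; apply/rowP => a.
have [c [cb ca]] := @sample_column 0 a le_rd isT.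
have := congr1 (fun w : 'rV[R]_d.+1 => w 0 c) us; rewrite !mxE (bigD1 a) //= big1.
  rewrite mxE ca eqxx cb mulr1n addr0 => /eqP; rewrite mulf_eq0 => /orP[/eqP//|].
  by rewrite -[_ == 0]/(root _ _) root_cube_poly_sample.
by move=> a' a'a; rewrite mxE ca val_eqE eq_sym (negPf a'a) mulr0n mulr0.
Qed.

(** Each condition provides [N + 1] distinct roots of a polynomial of degree at
    most [N]: values of a facet equation are values at a node, up to a nonzero
    factor, and the projection gives the values at the samples. *)
Theorem model_transversal : (0 < N)%N -> (4 * r + 3 <= d)%N ->
  exists C, [/\ coordinates C,
  model_frame = realize (model_frame \o @base N) C,
  forall i j, i != j -> C (v2 i j) (Some j) \in unitmx
  & transversal (model_frame \o @base N) (slope C)].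
Proof.
move=> N_gt0 le_rd; have [c [cP c_base c_supp]] := cube_poly_coordinates.
pose C (s : init_vertex N) o : 'M[R]_n := (c s o)%:M; exists C.
(* At [node j false] only the term of [Some j] survives, and the left side is
   nonzero. *)
have c_neq0 i j : i != j -> c (v2 i j) (Some j) != 0.
  move=> ij; have : ~~ root (cube_poly (val (v2 i j))) (node j false).
    by rewrite root_cube_poly_node !inE eqxx orbT.
  rewrite cP; apply: contraNneq => cj0; rewrite /root horner_sum big1 // => o _.
  rewrite hornerZ; case: (eqVneq o (Some j)) => [->|oj].
    by rewrite cj0 mul0r.
  rewrite (eqP (_ : root _ _)) ?mulr0 // root_cube_poly_node.
  by case: o oj => [l|] /=; rewrite inE // eq_sym (inj_eq Some_inj) => /negPf->.
have slopeE i j : i != j ->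
    slope C i j = (c (v2 i j) None / c (v2 i j) (Some j))%:M.
  by move=> ij; rewrite /slope /C invmx_scalar -scalar_mxM mulrC.
(* At [node i true] only the terms of [None] and [Some j] survive, and the
   left side vanishes. *)
have slope_root i j : i != j -> (cube_poly [set j]).[node i true] =
    - (c (v2 i j) None / c (v2 i j) (Some j)) * (cube_poly set0).[node i true].
  move=> ij; have /eqP : root (cube_poly (val (v2 i j))) (node i true).
    by rewrite root_cube_poly_node !inE eqxx.
  rewrite cP horner_sum (bigD1 None) // (bigD1 (Some j)) //= !hornerZ big1.
    have := c_neq0 _ _ ij; move: (c _ _) (c _ _) (_.[_]) (_.[_]) => p q x y q0.
    rewrite addr0 => /eqP; rewrite addrC addr_eq0 => /eqP h.
    by apply: (mulfI q0); rewrite h mulNr mulrN mulrCA !mulrA divfK.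
  move=> [l|] //=; rewrite hornerZ (inj_eq Some_inj) => lj.
  have [->|li] := eqVneq l i.
    by rewrite (eqP (_ : root _ _)) ?mulr0 // root_cube_poly_node inE eqxx.
  by rewrite c_supp ?mul0r // !inE negb_or li lj.
have facet_root l e v a : facet (slope C) l e v = 0 ->
    root (coord_poly v a) (node l e).
  move=> /(congr1 (fun w : 'rV[R]_n => w 0 a)).
  rewrite mxE /root /facet; case: e; last first.
    by rewrite horner_coord_poly_false => ->; rewrite mul0r.
  rewrite horner_coord_poly_true !mxE summxE => /eqP; rewrite subr_eq0 => /eqP->.
  rewrite mulr_suml -big_split big1 //= => j jl.
  have lj : l != j by rewrite eq_sym.
  rewrite slope_root // slopeE // mul_mx_scalar mxE.
  by rewrite mulNr mulrN mulrA (mulrC _ (v _ _ _)) subrr.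
have sample_root v a b : point (model_frame \o @base N) v = 0 -> (b < 4)%N ->
    root (coord_poly v a) (sample b).
  move=> vp b4; have [k [kb ka]] := sample_column a le_rd b4.
  by rewrite /root -kb -(point_model_frame v ka) vp mxE.
split.
- split=> [o o'|s j js]; rewrite /C; last by rewrite c_supp // raddf0.
  by rewrite c_base; case: eqP; rewrite ?raddf0.
- apply: funext => s; apply/matrixP => a k; rewrite /realize summxE.
  rewrite mxE cP horner_sum -sumrMnl; apply: eq_bigr => o _.
  by rewrite mul_scalar_mx !mxE hornerZ mulrnAr.
- by move=> i j ij; rewrite unitmxE det_scalar unitfE expf_neq0 ?c_neq0.
split=> [S j v vS vj|Z S v Z3 vZ vp]; apply: coord_poly_inj => // a.
  pose s := node j (j \notin S) :: [seq node l (l \in S) | l <- enum 'I_N].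
  apply: (@coord_poly_eq0 _ _ s).
  - by rewrite /= size_map size_enum_ord.
  - rewrite /= map_inj_uniq ?enum_uniq ?andbT => [|l m /eqP]; last first.
      by rewrite eq_node => /andP[/eqP].
    apply/mapP => -[l _ /eqP]; rewrite eq_node => /andP[/eqP-> /eqP].
    by case: (_ \in _).
  - rewrite /= facet_root //=; apply/allP => _ /mapP[l _ ->].
    exact: facet_root.
(* Here [N - 3] roots are nodes and four are samples. *)
pose s := [seq sample b | b <- iota 0 4] ++ [seq node l (l \in S) | l <- enum Z].
apply: (@coord_poly_eq0 _ _ s).
- rewrite size_cat !size_map size_iota -cardE.
  have ZN : (#|Z| + 3 = N)%N by rewrite -Z3 cardsC card_ord.
  by rewrite -[ltnLHS]ZN addnC ltn_add2r.
- rewrite cat_uniq !map_inj_uniq ?enum_uniq ?iota_uniq ?andbT /=.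
  + by apply/hasPn => _ /mapP[l _ ->]; rewrite !inE
      ![node _ _ == _]eq_sym !eq_sample_node.
  + by move=> l m /eqP; rewrite eq_node => /andP[/eqP].
  + by move=> b b' /eqP; rewrite eq_sample => /eqP.
rewrite all_cat; apply/andP; split; apply/allP => x /mapP[y yP ->].
  by move: yP; rewrite mem_iota; apply: sample_root.
by move: yP; rewrite mem_enum => /vZ; apply: facet_root.
Qed.

End Model.

(** * Density of the good initial data *)

Section Density.
Variables (R : realType) (d r N : nat).
Local Notation n := r.+1.
Local Notation frames := (init_vertex N -> 'M[R]_(n, d.+1)).
Local Notation alg := (entry_algebra R d r (init_vertex N)).

Definition segment m k (A0 A1 : 'M[R]_(m, k)) (t : R) : 'M[R]_(m, k) :=
  (1 - t) *: A0 + t *: A1.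

Lemma segment0 m k (A0 A1 : 'M[R]_(m, k)) : segment A0 A1 0 = A0.
Proof. by rewrite /segment subr0 scale1r scale0r addr0. Qed.

Lemma segment1 m k (A0 A1 : 'M[R]_(m, k)) : segment A0 A1 1 = A1.
Proof. by rewrite /segment subrr scale1r scale0r add0r. Qed.

Lemma segment_id m k (A : 'M[R]_(m, k)) t : segment A A t = A.
Proof. by rewrite /segment -scalerDl subrK scale1r. Qed.

Lemma curve_poly_segment m k (A0 A1 : 'M[R]_(m, k)) a c :
  curve_algebra R (fun t => segment A0 A1 t a c).
Proof.
exists ((1 - 'X) * (A0 a c)%:P + 'X * (A1 a c)%:P) => t.
by rewrite !hornerE !mxE.
Qed.

(** Initial data are parametrized by base frames and coordinates, subject to
    affine constraints, so a segment joins two of them.  The condition on [f]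
    holds near one end, the other conditions near the other end. *)
Lemma initial_data_irreducible (X0 : init_vertex N -> grass R d r)
    (A0 A1 : frames) M C1 (f g : frames -> R) :
  initial_data X0 -> frame X0 A0 -> alg f -> f A0 != 0 ->
  coordinates C1 -> A1 = realize (A1 \o @base N) C1 ->
  (forall s (u : 'rV_n), u *m A1 s = 0 -> u = 0) ->
  transversal (A1 \o @base N) M -> alg g -> g A1 != 0 ->
  exists X A, [/\ initial_data X, frame X A, f A != 0 & g A != 0].
Proof.
move=> initX0 frX0 algf f0 CC1 A1E inj1 trans1 algg g1.
have [_ [C0 [CC0 A0E]]] := initial_data_coordinates initX0 frX0.
pose B t o := segment (A0 (base o)) (A1 (base o)) t.
pose C t s o := segment (C0 s o) (C1 s o) t.
pose A t := realize (B t) (C t).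
have A_0 : A 0 = A0.
  apply: funext => s; rewrite A0E; apply: eq_bigr => o _.
  by rewrite /B /C !segment0.
have A_1 : A 1 = A1.
  rewrite A1E; apply: funext => s; apply: eq_bigr => o _.
  by rewrite /B /C !segment1.
have CC t : coordinates (C t).
  case: CC0 CC1 => base0 supp0 [base1 supp1]; split=> [o o'|s j js].
    by rewrite /C base0 base1 segment_id.
  by rewrite /C supp0 // supp1 // segment_id.
have polyA s a c : curve_algebra R (fun t => A t s a c).
  apply: (curve_poly_ext (f := fun t => \sum_o \sum_b C t s o a b * B t o b c)).
    by move=> t; rewrite /A /realize summxE; apply: eq_bigr => o _; rewrite mxE.
  apply: curve_poly_sum => o; apply: curve_poly_sum => b.
  by apply: curve_poly_mul; apply: curve_poly_segment.
have near0 : near (curve_algebra R) 0 (fun t => f (A t) != 0).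
  exists (fun t => f (A t)); rewrite A_0; split=> //.
  exact: curve_poly_entry_poly.
have near1 : near (curve_algebra R) 1 (fun t => g (A t) != 0).
  exists (fun t => g (A t)); rewrite A_1; split=> //.
  exact: curve_poly_entry_poly.
(* Constant slopes suffice: transversality serves only to keep the base
   frames independent. *)
have near_trans : near (curve_algebra R) 1 (fun t => transversal (B t) M).
  apply: (near_transversal (B := B) (M := fun=> M)).
  - by move=> o a c; apply: regular_poly; apply: curve_poly_segment.
  - by move=> i j _; apply: regular_mx_const.
  - rewrite (_ : B 1 = A1 \o @base N) //; apply: funext => o.
    exact: segment1.
have near_inj : near (curve_algebra R) 1 (fun t => forall s (u : 'rV_n),
    u *m A t s = 0 -> u = 0).
  apply: near_forall => s.
  pose Phi t (c : 'I_d.+1) (u : 'rV[R]_n) := (u *m A t s) 0 c.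
  have lin t c : scalar (Phi t c).
    by move=> a u v; rewrite /Phi mulmxDl -scalemxAl !mxE.
  have reg c u : regular (curve_algebra R) 1 (fun t => Phi t c u).
    apply: regular_mulmx; first exact: regular_mx_const.
    by move=> a b; apply: regular_poly; apply: polyA.
  apply: near_mono (near_injective lin reg _) => [t injt u uA|u u0].
    by apply: injt => c; rewrite /Phi uA mxE.
  by apply: (inj1 s); rewrite -A_1; apply/rowP => c; rewrite [RHS]mxE; apply: u0.
have [t [ft [gt [transt injt]]]] :=
  near_meet near0 (near_and near1 (near_and near_trans near_inj)).
have [X frX] := frame_exists injt; exists X, (A t); split=> //.
exact: coordinates_initial_data frX (CC t) (transversal_independent transt).
Qed.

End Density.

(** A closed set is cut out by polynomials; a point outside it has a frame on
    which one of them does not vanish. *)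
Lemma zariski_open_frame (R : realType) (d r : nat) (I : finType)
    (V : (I -> grass R d r) -> Prop) X : zariski_open V -> V X ->
  exists A f, [/\ frame X A, entry_algebra R d r I f, f A != 0
    & forall X' A', frame X' A' -> f A' != 0 -> V X'].
Proof.
move=> [F FP] VX; apply: contrapT => none.
apply: (proj2 (FP X)) VX => p Fp A frA.
apply/eqP; apply: contraPT isT => pA _.
apply: none; exists A, (fun A => p.@[entries A]); split=> //; first by exists p.
move=> X' A' frA' pA'; apply: contrapT => /FP/(_ p Fp A' frA') pA'0.
by rewrite pA'0 eqxx in pA'.
Qed.

Theorem theorem2 (R : realType) (r N d : nat)
    (hN : (4 <= N)%N) (hd : (4 * r + 3 <= d)%N) :
  generically (@initial_data R d r N)
    (fun X => exists! Y : {ffun {set 'I_N} -> grass R d r}, solution X Y).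
Proof.
have N_gt2 : (2 < N)%N by exact: ltnW.
have [C [CC AE unitC trans]] := model_transversal R (ltnW (ltnW N_gt2)) hd.
have [g [[p pE] g1 gP]] := near_solution N_gt2 CC AE unitC trans.
exists (fun X => exists A, frame X A /\ g A != 0); split.
- exists (eq p) => X; split=> [nW _ <- A frA|pX [A [frA]]].
    by apply/eqP; rewrite -pE; apply: contra_notT nW => gA; exists A.
  by rewrite pE pX ?eqxx.
- move=> V openV [X0 [initX0 VX0]].
  have [A0 [f [frX0 algf f0 fV]]] := zariski_open_frame openV VX0.
  have algg : entry_algebra R d r (init_vertex N) g by exists p.
  have [X [A [initX frX fA gA]]] := initial_data_irreducible initX0 frX0 algf f0
    CC AE (fun s u => @model_frame_free R r N d s u hd) trans algg g1.
  by exists X; split=> //; [apply: fV frX fA|exists A].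
- by move=> X initX [A [frA gA]]; apply: gP gA X initX frA.
Qed.
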